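(* Let $K\to R$ be a homomorphism of commutative rings, and let $R\to S_l$, $1\le l\le n$, be a finite collection of homomorphisms of commutative rings such that the collection of induced maps of the spectra $\mathrm{Spec}\,S_l\to\mathrm{Spec}\,R$ is an affine open covering of the affine scheme $\mathrm{Spec}\,R$. Let $U$ and $V$ be two $R$-modules, and let $D_l\colon S_l\otimes_RU\to S_l\otimes_RV$ be $K$-linear $S_l$-differential operators, defined for all indices $1\le l\le n$. For every pair of indices $j$ and $l$, put $S_{jl}=S_j\otimes_RS_l$. Assume that, for every pair of indices $j$ and $l$, the $S_{jl}$-differential operator $D_{jl}\colon S_{jl}\otimes_RU\to S_{jl}\otimes_RV$ induced by $D_l$ is equal (under the identification $S_{jl}\simeq S_{lj}$) to the $S_{lj}$-differential operator $D_{lj}\colon S_{lj}\otimes_RU\to S_{lj}\otimes_RV$ induced by $D_j$. Then there exists a unique $K$-linear $R$-differential operator $D\colon U\to V$ such that, for every index $l$, the $S_l$-differential operator $D_l$ is induced by $D$.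
   Context: For a homomorphism of commutative rings $K\to R$ and $R$-modules $U$, $V$, the group $E=\mathrm{Hom}_K(U,V)$ is an $R$-$R$-bimodule: $(re)(u)=r\,e(u)$, $(er)(u)=e(ru)$. For $r\in R$ put $\theta_r(e)=re-er$. A $K$-linear map $e\colon U\to V$ is a $K$-linear $R$-differential operator if for every $r\in R$ there exists an integer $n\ge0$ such that $(\theta_r)^{n+1}(e)=0$. Induced operators: if $A\to A'$ is a flat epimorphism of commutative $K$-algebras (an epimorphism in commutative rings with $A'$ flat over $A$), $M$, $N$ are $A$-modules and $D\colon M\to N$ is a $K$-linear $A$-differential operator, then there is a unique $K$-linear $A'$-differential operator $D'\colon A'\otimes_AM\to A'\otimes_AN$ with $D'(1\otimes m)=1\otimes D(m)$ for all $m\in M$; it is said to be induced by $D$. This is applied to $R\to S_l$ and to $S_l\to S_{jl}$, $S_j\to S_{jl}$, with the identifications $S_{jl}\otimes_{S_l}(S_l\otimes_RU)=S_{jl}\otimes_RU$, etc. An affine open covering means that every $\mathrm{Spec}\,S_l\to\mathrm{Spec}\,R$ is an open immersion and the images cover $\mathrm{Spec}\,R$ (so $R\to S_l$ are flat epimorphisms). *)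

(* Defs.v *)
From HB Require Import structures.
From mathcomp Require Import all_boot all_order all_algebra.
From mathcomp Require Import boolp classical_sets topology.

Set Implicit Arguments.
Unset Strict Implicit.
Unset Printing Implicit Defensive.

Import GRing.Theory.

Local Open Scope ring_scope.

(* Rings are [comPzRingType]s: the zero ring is allowed, as it must be (for
   instance S_j (x)_R S_l = 0 when the two opens of the covering are
   disjoint). *)

Section BaseChange.
Context {A B : comPzRingType} (f : {rmorphism A -> B}) (M : lmodType A).

(* B (x)_A M is the commutative monoid of finite formal sums of pairs (b, m),
   divided by the smallest congruence making (b, m) biadditive and
   A-balanced. It is a group, with - (b, m) = (- b, m). *)
Inductive tens_rel : seq (B * M) -> seq (B * M) -> Prop :=
| TensRefl s : tens_rel s s
| TensSym s t : tens_rel s t -> tens_rel t s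
| TensTrans s t u : tens_rel s t -> tens_rel t u -> tens_rel s u
| TensCat s s' t t' :
    tens_rel s s' -> tens_rel t t' -> tens_rel (s ++ t) (s' ++ t')
| TensComm s t : tens_rel (s ++ t) (t ++ s)
| Tens0 m : tens_rel [:: (0, m)] [::]
| TensDl b b' m : tens_rel [:: (b + b', m)] [:: (b, m); (b', m)]
| TensDr b m m' : tens_rel [:: (b, m + m')] [:: (b, m); (b, m')]
| TensBal b a m : tens_rel [:: (b * f a, m)] [:: (b, a *: m)].

Definition tens_relb : rel (seq (B * M)) := fun s t => `[< tens_rel s t >].

Lemma tens_relb_refl : reflexive tens_relb.
Proof. by move=> s; apply/asboolP/TensRefl. Qed.

Lemma tens_relb_sym : symmetric tens_relb.
Proof. by move=> s t; apply/asboolP/asboolP; apply: TensSym. Qed.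

Lemma tens_relb_trans : transitive tens_relb.
Proof.
by move=> t s u /asboolP st /asboolP tu; apply/asboolP/(TensTrans st tu).
Qed.

Canonical tens_equiv : equiv_rel (seq (B * M)) :=
  EquivRel tens_relb tens_relb_refl tens_relb_sym tens_relb_trans.

Definition base_change : Type := {eq_quot tens_equiv}%qT.

HB.instance Definition _ := Choice.on base_change.

Definition formal (s : seq (B * M)) : base_change :=
  (\pi_{eq_quot tens_equiv} s)%qT.

Definition tens (b : B) (m : M) : base_change := formal [:: (b, m)].

Definition formal_repr (x : base_change) : seq (B * M) :=
  repr (x : {eq_quot tens_equiv}%qT).

Lemma formal_reprK x : formal (formal_repr x) = x.
Proof. exact: reprK. Qed.

Lemma formalP s t : tens_rel s t <-> formal s = formal t.
Proof.
split=> [st|/eqmodP/asboolP //].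
by apply/eqmodP/asboolP.
Qed.

Definition bc_add (x y : base_change) := formal (formal_repr x ++ formal_repr y).
Definition bc_scale (c : B) (x : base_change) :=
  formal [seq (c * p.1, p.2) | p <- formal_repr x].

Lemma bc_addE s t : bc_add (formal s) (formal t) = formal (s ++ t).
Proof. by apply/formalP/TensCat; apply/formalP; rewrite formal_reprK. Qed.

Lemma tens_rel_scale c s t : tens_rel s t ->
  tens_rel [seq (c * p.1, p.2) | p <- s] [seq (c * p.1, p.2) | p <- t].
Proof.
elim=> {s t} /=.
- by move=> s; apply: TensRefl.
- by move=> s t _; apply: TensSym.
- by move=> s t u _ st _; apply: TensTrans.
- by move=> s s' t t' _ ss _ tt; rewrite !map_cat; apply: TensCat.
- by move=> s t; rewrite !map_cat; apply: TensComm.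
- by move=> m; rewrite mulr0; apply: Tens0.
- by move=> b b' m; rewrite mulrDr; apply: TensDl.
- by move=> b m m'; apply: TensDr.
- by move=> b a m; rewrite mulrA; apply: TensBal.
Qed.

Lemma bc_scaleE c s :
  bc_scale c (formal s) = formal [seq (c * p.1, p.2) | p <- s].
Proof. by apply/formalP/tens_rel_scale/formalP; rewrite formal_reprK. Qed.

Lemma bc_addA : associative bc_add.
Proof.
move=> x y z; rewrite -(formal_reprK x) -(formal_reprK y) -(formal_reprK z).
by rewrite !bc_addE catA.
Qed.

Lemma bc_addC : commutative bc_add.
Proof.
move=> x y; rewrite -(formal_reprK x) -(formal_reprK y) !bc_addE.
exact/formalP/TensComm.
Qed.

Lemma bc_add0 : left_id (formal [::]) bc_add.
Proof. by move=> x; rewrite -(formal_reprK x) bc_addE. Qed.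

Lemma bc_scaleDl c d x :
  bc_scale (c + d) x = bc_add (bc_scale c x) (bc_scale d x).
Proof.
have cons p s : formal (p :: s) = bc_add (formal [:: p]) (formal s).
  by rewrite bc_addE.
rewrite -(formal_reprK x) !bc_scaleE bc_addE.
elim: (formal_repr x) => //= -[b m] s IHs /=.
have -> : formal ((c * b, m) :: [seq (c * p.1, p.2) | p <- s] ++
    (d * b, m) :: [seq (d * p.1, p.2) | p <- s]) =
  bc_add (bc_add (formal [:: (c * b, m)]) (formal [:: (d * b, m)]))
    (bc_add (formal [seq (c * p.1, p.2) | p <- s])
       (formal [seq (d * p.1, p.2) | p <- s])).
  rewrite cons -bc_addE [formal (_ :: map _ _)]cons -!bc_addA.
  congr (bc_add _ _); rewrite !bc_addA; congr (bc_add _ _); exact: bc_addC.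
by rewrite cons IHs mulrDl (iffLR (formalP _ _) (TensDl _ _ _)) !bc_addE.
Qed.

Lemma bc_scale0 x : bc_scale 0 x = formal [::].
Proof.
rewrite -(formal_reprK x) bc_scaleE; elim: (formal_repr x) => //= -[b m] s IHs.
by rewrite /= -cat1s -bc_addE IHs mul0r (iffLR (formalP _ _) (Tens0 _)) bc_add0.
Qed.

Lemma bc_scale1 : left_id 1 bc_scale.
Proof.
move=> x; rewrite -(formal_reprK x) bc_scaleE; congr formal.
by rewrite -[RHS]map_id; apply: eq_map => -[b m]; rewrite /= mul1r.
Qed.

Lemma bc_addN : left_inverse (formal [::]) (bc_scale (- 1)) bc_add.
Proof.
by move=> x; rewrite -{2}(bc_scale1 x) -bc_scaleDl addNr bc_scale0.
Qed.

HB.instance Definition _ :=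
  GRing.isZmodule.Build base_change bc_addA bc_addC bc_add0 bc_addN.

Lemma bc_scaleA c d x : bc_scale c (bc_scale d x) = bc_scale (c * d) x.
Proof.
rewrite -(formal_reprK x) !bc_scaleE -map_comp; congr formal.
by apply: eq_map => p /=; rewrite mulrA.
Qed.

Lemma bc_scaleDr : right_distributive bc_scale +%R.
Proof.
move=> c x y; rewrite -(formal_reprK x) -(formal_reprK y).
rewrite [_ (formal _) (formal _) in LHS]bc_addE !bc_scaleE map_cat.
by rewrite [RHS]bc_addE.
Qed.

HB.instance Definition _ := GRing.Zmodule_isLmodule.Build B base_change
  bc_scaleA bc_scale1 bc_scaleDr (fun v c d => bc_scaleDl c d v).

Lemma tens0l m : tens 0 m = 0.
Proof. exact: (iffLR (formalP _ _) (Tens0 _)). Qed.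

Lemma tensDl b b' m : tens (b + b') m = tens b m + tens b' m.
Proof. by rewrite [RHS]bc_addE; exact: (iffLR (formalP _ _) (TensDl _ _ _)). Qed.

Lemma tensDr b m m' : tens b (m + m') = tens b m + tens b m'.
Proof. by rewrite [RHS]bc_addE; exact: (iffLR (formalP _ _) (TensDr _ _ _)). Qed.

Lemma tens_bal b a m : tens (b * f a) m = tens b (a *: m).
Proof. exact: (iffLR (formalP _ _) (TensBal _ _ _)). Qed.

Lemma scale_tens c b m : c *: tens b m = tens (c * b) m.
Proof. exact: bc_scaleE. Qed.

Lemma tens_ind (P : base_change -> Prop) :
  P 0 -> (forall b m, P (tens b m)) ->
  (forall x y, P x -> P y -> P (x + y)) -> forall x, P x.
Proof.
move=> P0 Pt PD x; rewrite -(formal_reprK x).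
elim: (formal_repr x) => [|[b m] s IHs]; first exact: P0.
by rewrite -cat1s -bc_addE; apply: PD IHs; apply: Pt.
Qed.

Definition balanced (W : zmodType) (h : B -> M -> W) : Prop :=
  [/\ forall b b' m, h (b + b') m = h b m + h b' m,
      forall b m m', h b (m + m') = h b m + h b m'
    & forall b a m, h (b * f a) m = h b (a *: m)].

(* The additive map B (x)_A M -> W with b (x) m |-> h b m. The defining
   formula is meaningful for balanced h only; see [tens_liftE]. *)
Definition tens_lift (W : zmodType) (h : B -> M -> W) (x : base_change) : W :=
  \sum_(p <- formal_repr x) h p.1 p.2.

Section Lift.
Context (W : zmodType) (h : B -> M -> W).
Hypothesis hP : balanced h.

Lemma tens_lift_formal s : tens_lift h (formal s) = \sum_(p <- s) h p.1 p.2.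
Proof.
case: hP => hDl hDr hB.
suff sumE t u : tens_rel t u ->
    \sum_(p <- t) h p.1 p.2 = \sum_(p <- u) h p.1 p.2.
  by apply/sumE/formalP; rewrite formal_reprK.
elim=> {s t u} //=.
- by move=> s t u _ -> _ ->.
- by move=> s s' t t' _ ss _ tt; rewrite !big_cat ss tt.
- by move=> s t; rewrite !big_cat; apply: addrC.
- move=> m; rewrite big_seq1 big_nil /=.
  by apply: (addrI (h 0 m)); rewrite -hDl !addr0.
- by move=> b b' m; rewrite !big_cons !big_nil !addr0 /= hDl.
- by move=> b m m'; rewrite !big_cons !big_nil !addr0 /= hDr.
- by move=> b a m; rewrite !big_seq1 /= hB.
Qed.

Lemma tens_liftE b m : tens_lift h (tens b m) = h b m.
Proof. by rewrite tens_lift_formal big_seq1. Qed.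

Lemma tens_liftD x y : tens_lift h (x + y) = tens_lift h x + tens_lift h y.
Proof.
rewrite -(formal_reprK x) -(formal_reprK y) [_ + _ in LHS]bc_addE.
by rewrite !tens_lift_formal big_cat.
Qed.

Lemma tens_lift0 : tens_lift h 0 = 0.
Proof. by apply: (addrI (tens_lift h 0)); rewrite -tens_liftD !addr0. Qed.

End Lift.

Lemma balancedD (W : zmodType) (h h' : B -> M -> W) :
  balanced h -> balanced h' -> balanced (fun b m => h b m + h' b m).
Proof.
move=> [hl hr hb] [hl' hr' hb']; split=> *; rewrite ?hl ?hl' ?hr ?hr' ?hb ?hb' //;
by rewrite addrACA.
Qed.

End BaseChange.

Arguments tens_lift {A B} f {M W} h x.

Definition restr {A B : comPzRingType} (f : {rmorphism A -> B}) : Type := B.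

Section Restr.
Context {A B : comPzRingType} (f : {rmorphism A -> B}).

HB.instance Definition _ := GRing.Zmodule.copy (restr f) B.

Definition restr_scale (a : A) (b : restr f) : restr f := f a * (b : B).

Lemma restr_scaleA a a' b :
  restr_scale a (restr_scale a' b) = restr_scale (a * a') b.
Proof. by rewrite /restr_scale mulrA rmorphM. Qed.

Lemma restr_scale1 : left_id 1 restr_scale.
Proof. by move=> b; rewrite /restr_scale rmorph1 mul1r. Qed.

Lemma restr_scaleDr : right_distributive restr_scale +%R.
Proof. by move=> a b b'; rewrite /restr_scale; apply: mulrDr. Qed.

Lemma restr_scaleDl b : {morph restr_scale^~ b : a a' / a + a'}.
Proof. by move=> a a'; rewrite /restr_scale rmorphD; apply: mulrDl. Qed.

HB.instance Definition _ := GRing.Zmodule_isLmodule.Build A (restr f)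
  restr_scaleA restr_scale1 restr_scaleDr restr_scaleDl.

End Restr.

(* B (x)_A C for f : A -> B and g : A -> C *)
Definition tensor_alg {A B C : comPzRingType}
  (f : {rmorphism A -> B}) (g : {rmorphism A -> C}) : Type :=
  base_change f (restr g).

Section TensorAlg.
Context {A B C : comPzRingType}.
Variables (f : {rmorphism A -> B}) (g : {rmorphism A -> C}).

HB.instance Definition _ :=
  GRing.Zmodule.copy (tensor_alg f g) (base_change f (restr g)).

Definition atens (b : B) (c : C) : tensor_alg f g :=
  tens f (b : B) (c : restr g).

Definition ta_mul (x y : tensor_alg f g) : tensor_alg f g :=
  tens_lift f (fun (b : B) (c : restr g) =>
    tens_lift f (fun (b' : B) (c' : restr g) => atens (b * b') ((c : C) * c')) y) x.

Lemma atensDl b b' c : atens (b + b') c = atens b c + atens b' c.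
Proof. exact: tensDl. Qed.

Lemma atensDr b c c' : atens b (c + c') = atens b c + atens b c'.
Proof. exact: tensDr. Qed.

Lemma atens_bal b a c : atens (b * f a) c = atens b (g a * c).
Proof. exact: tens_bal. Qed.

Lemma atens_ind (P : tensor_alg f g -> Prop) :
  P 0 -> (forall b c, P (atens b c)) ->
  (forall x y, P x -> P y -> P (x + y)) -> forall x, P x.
Proof. exact: (@tens_ind _ _ f (restr g)). Qed.

Lemma ta_bal1 b c : balanced f
  (fun (b' : B) (c' : restr g) => atens (b * b') ((c : C) * c')).
Proof.
split=> [b1 b2 c'|b' c1 c2|b' a c'].
- by rewrite mulrDr atensDl.
- by rewrite mulrDr atensDr.
- by rewrite mulrA atens_bal mulrCA.
Qed.

Lemma ta_bal2 y : balanced f (fun (b : B) (c : restr g) =>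
  tens_lift f (fun (b' : B) (c' : restr g) => atens (b * b') ((c : C) * c')) y).
Proof.
split=> [b1 b2 c|b c1 c2|b a c]; elim/atens_ind: y => [|b' c'|x y IHx IHy];
  rewrite ?(tens_lift0 (ta_bal1 _ _)) ?(tens_liftE (ta_bal1 _ _))
        ?(tens_liftD (ta_bal1 _ _)) ?addr0 //.
- by rewrite mulrDl atensDl.
- by rewrite IHx IHy addrACA.
- by rewrite mulrDl atensDr.
- by rewrite IHx IHy addrACA.
- by rewrite mulrAC atens_bal mulrA.
- by rewrite IHx IHy.
Qed.

Lemma ta_mulE1 b c y : ta_mul (atens b c) y =
  tens_lift f (fun (b' : B) (c' : restr g) => atens (b * b') ((c : C) * c')) y.
Proof. by rewrite /ta_mul (tens_liftE (ta_bal2 y)).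
Qed.

Lemma ta_mulE b c b' c' :
  ta_mul (atens b c) (atens b' c') = atens (b * b') (c * c').
Proof. by rewrite ta_mulE1 (tens_liftE (ta_bal1 _ _)). Qed.

Lemma ta_mulDl : left_distributive ta_mul +%R.
Proof. by move=> x y z; apply/tens_liftD/ta_bal2. Qed.

Lemma ta_mul0l y : ta_mul 0 y = 0.
Proof. exact/tens_lift0/ta_bal2. Qed.

Lemma ta_mulC : commutative ta_mul.
Proof.
have mul0 x : ta_mul x 0 = 0.
  elim/atens_ind: x => [|b c|x y IHx IHy].
  - exact: ta_mul0l.
  - by rewrite ta_mulE1 (tens_lift0 (ta_bal1 _ _)).
  - by rewrite ta_mulDl IHx IHy addr0.
have mulD x y z : ta_mul x (y + z) = ta_mul x y + ta_mul x z.
  elim/atens_ind: x => [|b c|x x' IHx IHx'].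
  - by rewrite !ta_mul0l addr0.
  - by rewrite !ta_mulE1 (tens_liftD (ta_bal1 _ _)).
  - by rewrite !ta_mulDl IHx IHx' addrACA.
move=> x y; elim/atens_ind: x => [|b c|x x' IHx IHx'].
- by rewrite ta_mul0l mul0.
- elim/atens_ind: y => [|b' c'|y y' IHy IHy'].
  + by rewrite ta_mul0l mul0.
  + by rewrite !ta_mulE mulrC (mulrC c).
  + by rewrite mulD ta_mulDl IHy IHy'.
- by rewrite mulD ta_mulDl IHx IHx'.
Qed.

Lemma ta_mulDr : right_distributive ta_mul +%R.
Proof. by move=> x y z; rewrite ta_mulC ta_mulDl !(ta_mulC x). Qed.

Lemma ta_mulA : associative ta_mul.
Proof.
have mul0r x : ta_mul x 0 = 0 by rewrite ta_mulC ta_mul0l.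
move=> x y z; elim/atens_ind: x => [|b c|x x' IHx IHx'].
- by rewrite !ta_mul0l.
- elim/atens_ind: y => [|b' c'|y y' IHy IHy'].
  + by rewrite ta_mul0l mul0r ta_mul0l.
  + elim/atens_ind: z => [|b'' c''|z z' IHz IHz'].
    * by rewrite !mul0r.
    * by rewrite !ta_mulE !mulrA.
    * by rewrite !ta_mulDr IHz IHz'.
  + by rewrite ta_mulDr !ta_mulDl ta_mulDr IHy IHy'.
- by rewrite !ta_mulDl IHx IHx'.
Qed.

Lemma ta_mul1 : left_id (atens 1 1) ta_mul.
Proof.
move=> x; elim/atens_ind: x => [|b c|x x' IHx IHx'].
- by rewrite ta_mulC ta_mul0l.
- by rewrite ta_mulE !mul1r.
- by rewrite ta_mulDr IHx IHx'.
Qed.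

HB.instance Definition _ := GRing.Zmodule_isComPzRing.Build (tensor_alg f g)
  ta_mulA ta_mulC ta_mul1 ta_mulDl.

Lemma atensM b c b' c' : atens b c * atens b' c' = atens (b * b') (c * c').
Proof. exact: ta_mulE. Qed.

End TensorAlg.

Section TensorAlgMaps.
Context {A B C : comPzRingType}.
Variables (f : {rmorphism A -> B}) (g : {rmorphism A -> C}).

(* the structure map of the A-algebra B (x)_A C; see also [ta_structE] *)
Definition ta_struct (a : A) : tensor_alg f g := atens f g (f a) 1.

Lemma ta_structE a : ta_struct a = atens f g 1 (g a).
Proof. by rewrite /ta_struct -[f a]mul1r atens_bal mulr1. Qed.

Lemma ta_struct_additive : zmod_morphism ta_struct.
Proof.
move=> a a'; apply: (addIr (ta_struct a')); rewrite subrK.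
by rewrite /ta_struct -atensDl -rmorphD subrK.
Qed.

Lemma ta_struct_multiplicative : monoid_morphism ta_struct.
Proof.
by split=> [|a a']; rewrite /ta_struct ?rmorph1 // atensM -rmorphM mulr1.
Qed.

HB.instance Definition _ :=
  GRing.isZmodMorphism.Build A (tensor_alg f g) ta_struct ta_struct_additive.
HB.instance Definition _ := GRing.isMonoidMorphism.Build A (tensor_alg f g)
  ta_struct ta_struct_multiplicative.

(* C -> B (x)_A C *)
Definition ta_inr (c : C) : tensor_alg f g := atens f g 1 c.

Lemma ta_inr_additive : zmod_morphism ta_inr.
Proof.
move=> c c'; apply: (addIr (ta_inr c')); rewrite subrK.
by rewrite /ta_inr -atensDr subrK.
Qed.

Lemma ta_inr_multiplicative : monoid_morphism ta_inr.
Proof. by split=> [|c c'] //; rewrite /ta_inr atensM mulr1. Qed.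

HB.instance Definition _ :=
  GRing.isZmodMorphism.Build C (tensor_alg f g) ta_inr ta_inr_additive.
HB.instance Definition _ := GRing.isMonoidMorphism.Build C (tensor_alg f g)
  ta_inr ta_inr_multiplicative.

Lemma ta_inr_struct a : ta_inr (g a) = ta_struct a.
Proof. by rewrite ta_structE. Qed.

Definition ta_swap (x : tensor_alg f g) : tensor_alg g f :=
  tens_lift f (fun (b : B) (c : restr g) => atens g f c b) x.

Lemma ta_swap_balanced :
  balanced f (fun (b : B) (c : restr g) => atens g f c b).
Proof.
split=> [b b' c|b c c'|b a c].
- exact: atensDr.
- exact: atensDl.
- by rewrite [b * _]mulrC -atens_bal mulrC.
Qed.

Lemma ta_swapE b c : ta_swap (atens f g b c) = atens g f c b.
Proof. exact: (tens_liftE ta_swap_balanced). Qed.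

Lemma ta_swapD x y : ta_swap (x + y) = ta_swap x + ta_swap y.
Proof. exact: (tens_liftD ta_swap_balanced). Qed.

End TensorAlgMaps.

Lemma ta_swapK {A B C : comPzRingType}
    (f : {rmorphism A -> B}) (g : {rmorphism A -> C}) :
  cancel (@ta_swap A B C f g) (@ta_swap A C B g f).
Proof.
move=> x; elim/(@atens_ind A B C f g): x => [|b c|x y IHx IHy].
- by rewrite /ta_swap !(tens_lift0 (ta_swap_balanced _ _)).
- by rewrite !ta_swapE.
- by rewrite !ta_swapD IHx IHy.
Qed.

(* sigma (x) M : B (x)_A M -> B' (x)_A M, for an A-linear sigma : B -> B' *)
Definition bc_map {A B B' : comPzRingType}
    {f : {rmorphism A -> B}} {f' : {rmorphism A -> B'}}
    (sigma : B -> B') {M : lmodType A} (x : base_change f M) :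
    base_change f' M :=
  tens_lift f (fun b m => tens f' (sigma b) m) x.

Section BcMap.
Context {A B B' : comPzRingType}.
Context (f : {rmorphism A -> B}) (f' : {rmorphism A -> B'}) (sigma : B -> B').
Hypothesis sigmaD : {morph sigma : x y / x + y}.
Hypothesis sigmaM : forall b a, sigma (b * f a) = sigma b * f' a.
Variable M : lmodType A.

Lemma bc_map_balanced :
  balanced f (fun b (m : M) => tens f' (sigma b) m).
Proof.
split=> [b b' m|b m m'|b a m].
- by rewrite sigmaD tensDl.
- by rewrite tensDr.
- by rewrite sigmaM tens_bal.
Qed.

Lemma bc_mapE b (m : M) :
  bc_map (f' := f') sigma (tens f b m) = tens f' (sigma b) m.
Proof. exact: (tens_liftE bc_map_balanced). Qed.

Lemma bc_mapD (x y : base_change f M) : bc_map (f' := f') sigma (x + y) =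
  bc_map (f' := f') sigma x + bc_map (f' := f') sigma y.
Proof. exact: (tens_liftD bc_map_balanced). Qed.

End BcMap.

(* The identification C (x)_B (B (x)_A M) = C (x)_A M, for ring maps
   f : A -> B, g : B -> C, and h : A -> C pointwise equal to g \o f, sends
   c (x) (b (x) m) to (c * g b) (x) m; see [bc_transE], [bc_trans_bij]. *)
Definition bc_trans {A B C : comPzRingType} {f : {rmorphism A -> B}}
    {g : {rmorphism B -> C}} (h : {rmorphism A -> C}) {M : lmodType A}
    (x : base_change g (base_change f M)) : base_change h M :=
  tens_lift g (fun c y => tens_lift f (fun b m => tens h (c * g b) m) y) x.

Section BcTrans.
Context {A B C : comPzRingType}.
Context (f : {rmorphism A -> B}) (g : {rmorphism B -> C}).
Context (h : {rmorphism A -> C}) (hE : h =1 g \o f) (M : lmodType A).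

Lemma bc_trans_balanced1 c :
  balanced f (fun b (m : M) => tens h (c * g b) m).
Proof.
split=> [b b' m|b m m'|b a m].
- by rewrite rmorphD mulrDr tensDl.
- by rewrite tensDr.
- by rewrite rmorphM mulrA -[g (f a)]hE tens_bal.
Qed.

Lemma bc_trans_balanced2 : balanced g (fun c (y : base_change f M) =>
  tens_lift f (fun b m => tens h (c * g b) m) y).
Proof.
split=> [c c' y|c y y'|c b' y].
- elim/(@tens_ind _ _ f M): y => [|b m|y y' IH IH'].
  + by rewrite !(tens_lift0 (bc_trans_balanced1 _)) addr0.
  + by rewrite !(tens_liftE (bc_trans_balanced1 _)) mulrDl tensDl.
  + by rewrite !(tens_liftD (bc_trans_balanced1 _)) IH IH' addrACA.
- exact: (tens_liftD (bc_trans_balanced1 _)).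
- elim/(@tens_ind _ _ f M): y => [|b m|y y' IH IH'].
  + by rewrite scaler0 !(tens_lift0 (bc_trans_balanced1 _)).
  + by rewrite scale_tens !(tens_liftE (bc_trans_balanced1 _)) rmorphM mulrA.
  + by rewrite scalerDr !(tens_liftD (bc_trans_balanced1 _)) IH IH'.
Qed.

Lemma bc_transD (x y : base_change g (base_change f M)) :
  bc_trans h (x + y) = bc_trans h x + bc_trans h y.
Proof. exact: (tens_liftD bc_trans_balanced2). Qed.

Lemma bc_trans0 : bc_trans h (0 : base_change g (base_change f M)) = 0.
Proof. exact: (tens_lift0 bc_trans_balanced2). Qed.

Lemma bc_transE c b (m : M) :
  bc_trans h (tens g c (tens f b m)) = tens h (c * g b) m.
Proof.
by rewrite /bc_trans (tens_liftE bc_trans_balanced2)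
           (tens_liftE (bc_trans_balanced1 c)).
Qed.

Lemma bc_trans_bij :
  bijective (bc_trans h : base_change g (base_change f M) -> base_change h M).
Proof.
have bal : balanced h (fun c (m : M) => tens g c (tens f 1 m)).
  split=> [c c' m|c m m'|c a m].
  - by rewrite tensDl.
  - by rewrite tensDr tensDr.
  - by rewrite [h a]hE tens_bal scale_tens mulr1 -tens_bal mul1r.
exists (tens_lift h (fun c m => tens g c (tens f 1 m))) => x.
- elim/(@tens_ind _ _ g (base_change f M)): x => [|c y|x y IHx IHy].
  + by rewrite bc_trans0 (tens_lift0 bal).
  + elim/(@tens_ind _ _ f M): y => [|b m|y y' IHy IHy'].
    * have -> : tens g c (0 : base_change f M) = 0.
        by apply: (addrI (tens g c 0)); rewrite -tensDr !addr0.
      by rewrite bc_trans0 (tens_lift0 bal).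
    * by rewrite bc_transE (tens_liftE bal) tens_bal scale_tens mulr1.
    * by rewrite tensDr bc_transD (tens_liftD bal) IHy IHy'.
  + by rewrite bc_transD (tens_liftD bal) IHx IHy.
- elim/(@tens_ind _ _ h M): x => [|c m|x y IHx IHy].
  + by rewrite (tens_lift0 bal) bc_trans0.
  + by rewrite (tens_liftE bal) bc_transE rmorph1 mulr1.
  + by rewrite (tens_liftD bal) bc_transD IHx IHy.
Qed.

End BcTrans.

Definition theta {A : comPzRingType} {M N : lmodType A} (a : A)
    (e : M -> N) : M -> N :=
  fun x => a *: e x - e (a *: x).

(* K-linear A-differential operators, for a K-algebra i : K -> A *)
Definition diff_op {K A : comPzRingType} (i : {rmorphism K -> A})
    {M N : lmodType A} (D : M -> N) : Prop :=
  (forall k x y, D (i k *: x + y) = i k *: D x + D y) /\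
  (forall a, exists n : nat, forall x, iter n.+1 (theta a) D x = 0).

(* D' : B (x)_A M -> B (x)_A N is induced by D : M -> N; here B is a
   K-algebra through i *)
Definition induced {K A B : comPzRingType} (i : {rmorphism K -> B})
    (f : {rmorphism A -> B}) {M N : lmodType A} (D : M -> N)
    (D' : base_change f M -> base_change f N) : Prop :=
  diff_op i D' /\ forall m, D' (tens f 1 m) = tens f 1 (D m).

(* The same, for D : B (x)_A M -> B (x)_A N, a ring map g : B -> C, and after
   the identification of C (x)_B (B (x)_A -) with C (x)_A -. *)
Definition induced_trans {K A B C : comPzRingType} (i : {rmorphism K -> C})
    {f : {rmorphism A -> B}} (g : {rmorphism B -> C}) {h : {rmorphism A -> C}}
    {M N : lmodType A} (D : base_change f M -> base_change f N)
    (D' : base_change h M -> base_change h N) : Prop :=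
  diff_op i D' /\
  forall x, D' (bc_trans h (tens g 1 x)) = bc_trans h (tens g 1 (D x)).

Local Open Scope classical_set_scope.

Record prime_ideal (A : comPzRingType) (P : set A) : Prop := PrimeIdeal {
  prime0 : P 0;
  primeD : forall x y, P x -> P y -> P (x + y);
  primeMl : forall a x, P x -> P (a * x);
  prime1 : ~ P 1;
  primeM : forall x y, P (x * y) -> P x \/ P y }.

Record spec (A : comPzRingType) := Spec {
  spec_set :> set A;
  specP : prime_ideal spec_set }.

HB.instance Definition _ (A : comPzRingType) := gen_eqMixin (spec A).
HB.instance Definition _ (A : comPzRingType) := gen_choiceMixin (spec A).

(* the complement of V(E) *)
Definition zariski_open (A : comPzRingType) (E : set A) : set (spec A) :=
  [set p | ~ E `<=` p].

Section Zariski.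
Variable A : comPzRingType.

Let zopen : set_system (spec A) := range (@zariski_open A).

Let zopenT : zopen setT.
Proof.
exists setT => //; apply/seteqP; split=> // p _ /= sTp.
exact: (prime1 (specP p) (sTp 1 I)).
Qed.

Let zopenI : setI_closed zopen.
Proof.
move=> _ _ [E _ <-] [F _ <-].
exists [set z | exists x y, [/\ E x, F y & z = x * y]] => //.
apply/seteqP; split=> p /=.
- move=> nEFp; split=> [Ep|Fp]; apply: nEFp => _ [x [y [Ex Fy ->]]].
  + by rewrite mulrC; apply: (primeMl (specP p)); apply: Ep.
  + by apply: (primeMl (specP p)); apply: Fp.
- move=> [nEp nFp] EFp; apply: nEp => x Ex; apply: contrapT => npx.
  apply: nFp => y Fy.
  have /(primeM (specP p)) [] // : spec_set p (x * y) by apply: EFp; exists x, y.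
Qed.

Let zopen_bigU (I : Type) (U : I -> set (spec A)) :
  (forall i, zopen (U i)) -> zopen (\bigcup_i U i).
Proof.
move=> opU.
exists [set x | exists2 E, zariski_open E `<=` \bigcup_i U i & E x] => //.
apply/seteqP; split=> p /=.
- move=> nEp; apply: contrapT => nUp; apply: nEp => x [E sEU Ex].
  apply: contrapT => npx; apply: nUp; apply: sEU => sEp; apply: npx.
  exact: sEp.
- move=> [i _ Uip] sp; have [E _ EU] := opU i.
  move: (Uip); rewrite -EU => nEp; apply: nEp => x Ex; apply: sp.
  by exists E => //; rewrite EU => q Uiq; exists i.
Qed.

HB.instance Definition _ := isOpenTopological.Build (spec A)
  zopenT zopenI zopen_bigU.

Lemma spec_openE (W : set (spec A)) :
  open W <-> exists E, W = zariski_open E.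
Proof. by split=> [[E _ <-]|[E ->]]; exists E. Qed.

End Zariski.

Section SpecMap.
Context {A B : comPzRingType} (f : {rmorphism A -> B}).

Lemma spec_map_subproof (q : spec B) : prime_ideal (f @^-1` q).
Proof.
have [q0 qD qM q1 qP] := specP q.
split=> /= [|x y|a x||x y].
- by rewrite rmorph0.
- by rewrite rmorphD; apply: qD.
- by rewrite rmorphM; apply: qM.
- by rewrite rmorph1.
- by rewrite rmorphM; apply: qP.
Qed.

Definition spec_map (q : spec B) : spec A := Spec (spec_map_subproof q).

End SpecMap.

(* The elements x / s of the local ring A_p are encoded by the pairs (x, s)
   with s not in p, up to [loc_eq]. *)
Definition fractions (A : comPzRingType) (p : spec A) : set (A * A) :=
  [set z | ~ spec_set p z.2].

Definition loc_eq (A : comPzRingType) (p : spec A) (y z : A * A) : Prop :=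
  exists2 u, ~ spec_set p u & u * (y.1 * z.2 - z.1 * y.2) = 0.

(* The homomorphism A_(f^-1 q) -> B_q, x / s |-> f x / f s, is bijective. *)
Definition stalk_iso {A B : comPzRingType} (f : {rmorphism A -> B})
    (q : spec B) : Prop :=
  let p := spec_map f q in
  let fq (y : A * A) := (f y.1, f y.2) in
  (forall y z, fractions p y -> fractions p z ->
     loc_eq q (fq y) (fq z) -> loc_eq p y z) /\
  (forall z, fractions q z -> exists2 y, fractions p y & loc_eq q (fq y) z).

Definition open_embedding {X Y : topologicalType} (phi : X -> Y) : Prop :=
  [/\ injective phi, continuous phi, open (range phi) &
      forall W, open W -> exists2 O, open O & phi @` W = O `&` range phi].

(* Spec B -> Spec A is a homeomorphism onto an open subspace, and the map of
   structure sheaves is an isomorphism, which is tested on stalks. *)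
Definition open_immersion {A B : comPzRingType}
    (f : {rmorphism A -> B}) : Prop :=
  open_embedding (spec_map f) /\ forall q, stalk_iso f q.

Definition affine_open_covering {A : comPzRingType} {n : nat}
    {S : 'I_n -> comPzRingType} (f : forall l, {rmorphism A -> S l}) : Prop :=
  (forall l, open_immersion (f l)) /\
  \bigcup_(l in setT) range (spec_map (f l)) = setT.

(* Main.v *)
Require Import Defs.
From HB Require Import structures.
From mathcomp Require Import all_boot all_order all_algebra.
From mathcomp Require Import boolp classical_sets functions topology.
From mathcomp Require Import ring.

(** An open immersion Spec B -> Spec A is, at each point q of Spec B, a
    localization at the multiplicative set T of the t in A not vanishing at q:
    elements of B are fractions with denominators in T, and the elements of M
    dying in B (x)_A M are T-torsion. This description passes to base changes
    and gives injectivity of V -> prod_l S_l (x) V and the gluing of sections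
    agreeing on the overlaps.

    The operators D_jl exist because, for a flat epimorphism A -> B and a
    B-module W, a differential operator e : M -> W can be multiplied on the
    right by b in B. If sum_i s_i t_i = 1 in B with t_i b = r_i in A, then
    sum_i s_i e t_i differs from e by a nilpotent operator applied to e, hence
    e = sum_i s_i h t_i for some h, and e b := sum_i s_i h r_i. The induced
    operator is b (x) m |-> (e b)(m), and D(u) is glued from the D_l(1 (x) u). *)

Set Implicit Arguments.
Unset Strict Implicit.
Unset Printing Implicit Defensive.

Import GRing.Theory.
Local Open Scope ring_scope.

(** * Localizations attached to an open immersion *)

Section PrimeIdeals.
Local Open Scope classical_set_scope.
Variable A : comPzRingType.

Definition is_ideal (I : set A) : Prop :=
  [/\ I 0, forall x y, I x -> I y -> I (x + y) & forall a x, I x -> I (a * x)].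

Definition mult_set (T : set A) : Prop :=
  T 1 /\ forall x y, T x -> T y -> T (x * y).

Lemma mult_set_not_prime (p : spec A) : mult_set [set t | ~ spec_set p t].
Proof.
by split=> [|x y nx ny /(primeM (specP p)) []] //; apply/prime1/specP.
Qed.

(** An ideal maximal among those containing [I] and disjoint from [T] is prime; Zorn's lemma
    provides one. *)
Lemma prime_avoiding (I T : set A) : is_ideal I -> mult_set T ->
  (forall x, I x -> ~ T x) ->
  exists2 p : spec A, I `<=` p & forall x, spec_set p x -> ~ T x.
Proof.
move=> idI [T1 TM] IT.
(* [P] speaks of the union of [I] and [X], so that the empty set, which is the union of the empty
   chain, satisfies it. *)
pose P (X : set A) := is_ideal (I `|` X) /\ forall x, (I `|` X) x -> ~ T x.
have [F FP Ftot|X [[[X0 XD XM] XT] Xmax]] := @Zorn_bigcup A P.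
  have [I0 ID IM] := idI; split; first split.
  - by left.
  - move=> x y [Ix|[X FX Xx]] [Iy|[Y FY Yy]].
    + by left; apply: ID.
    + have [[_ YD _] _] := FP _ FY.
      by have [|Yxy] := YD x y (or_introl Ix) (or_intror Yy); [left|right; exists Y].
    + have [[_ XD _] _] := FP _ FX.
      by have [|Xxy] := XD x y (or_intror Xx) (or_introl Iy); [left|right; exists X].
    + have [XY|YX] := Ftot _ _ FX FY.
      * have [[_ YD _] _] := FP _ FY.
        by have [|Yxy] := YD x y (or_intror (XY _ Xx)) (or_intror Yy);
          [left|right; exists Y].
      * have [[_ XD _] _] := FP _ FX.
        by have [|Xxy] := XD x y (or_intror Xx) (or_intror (YX _ Yy));
          [left|right; exists X].
  - move=> a x [Ix|[X FX Xx]]; first by left; apply: IM.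
    have [[_ _ XM] _] := FP _ FX.
    by have [|Xax] := XM a x (or_intror Xx); [left|right; exists X].
  - move=> x [Ix|[X FX Xx]]; first exact: IT.
    by have [_] := FP _ FX; apply; right.
pose J := I `|` X.
(* By maximality the ideal [J + A x], called [Y] below, meets [T]. If [x * y] is in [J], two such
   elements of [T], for [x] and [y], have their product in [J]. *)
have meetT x : ~ J x -> exists y a, J y /\ T (y + a * x).
  move=> nJx; pose Y := [set z | exists y a, J y /\ z = y + a * x].
  apply: contrapT => nT; apply: (Xmax Y).
    split=> [z Xz|YX].
      by exists z, 0; split; [right|rewrite mul0r addr0].
    apply: nJx; right; apply: YX; exists 0, 1; split; first by left; case: idI.
    by rewrite add0r mul1r.
  have -> : P Y = (is_ideal Y /\ forall x, Y x -> ~ T x).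
    rewrite /P; suff -> : I `|` Y = Y by [].
    apply/seteqP; split=> z; last by right.
    by case=> // Iz; exists z, 0; split; [left|rewrite mul0r addr0].
  split; first split.
  - by exists 0, 0; split => //; rewrite mul0r addr0.
  - move=> _ _ [y [a [Jy ->]]] [z [b [Jz ->]]].
    by exists (y + z), (a + b); split; [exact: XD|ring].
  - move=> c _ [y [a [Jy ->]]]; exists (c * y), (c * a).
    by split; [exact: XM|ring].
  - by move=> _ [y [a [Jy ->]]] Tz; apply: nT; exists y, a.
have Jprime : prime_ideal J.
  split=> // [J1|x y Jxy]; first exact: (XT 1).
  apply: contrapT => /not_orP [/meetT [z [a [Jz Tz]]] /meetT [w [b [Jw Tw]]]].
  apply: (XT _ _ (TM _ _ Tz Tw)).
  have -> : (z + a * x) * (w + b * y) =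
    (w + b * y) * z + (a * x * w + a * b * (x * y)) by ring.
  by apply: (XD); [exact: XM|apply: XD; exact: XM].
by exists (Spec Jprime) => [x Ix|x]; [left|exact: XT].
Qed.

(** A proper ideal would avoid [{1}] and hence lie in a prime. *)
Lemma ideal_eq1 (I : set A) : is_ideal I ->
  (forall p : spec A, exists2 t, I t & ~ spec_set p t) -> I 1.
Proof.
move=> idI Ip; apply: contrapT => nI1.
have [||p sIp _] := @prime_avoiding I [set 1] idI.
- by split => // x y -> ->; rewrite mulr1.
- by move=> x Ix x1; apply: nI1; rewrite -x1.
by have [t /sIp] := Ip p.
Qed.

End PrimeIdeals.

(** * Denominators generating the unit ideal *)

Section Covers.
Local Open Scope classical_set_scope.
Context {A B : comPzRingType} (g : {rmorphism A -> B}).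

(** Geometrically, the opens where some [g t] with [t] in [I] does not vanish cover Spec B. The
    coefficients of the relation later serve to build operators. *)
Definition covers (I : set A) : Prop :=
  exists c : seq (B * A),
    {in c, forall p, I p.2} /\ \sum_(p <- c) p.1 * g p.2 = 1.

Lemma covers_local (I : set A) :
  (forall q : spec B, exists2 t, I t & ~ spec_set q (g t)) -> covers I.
Proof.
move=> Iq; pose J := [set x | exists c : seq (B * A),
  {in c, forall p, I p.2} /\ \sum_(p <- c) p.1 * g p.2 = x].
suff: J 1 by [].
apply: ideal_eq1 => [|q].
  split=> [|x y [c [cI <-]] [d [dI <-]]|a x [c [cI <-]]].
  - by exists [::]; split => //; rewrite big_nil.
  - exists (c ++ d); split; last by rewrite big_cat.
    move=> p.
    by rewrite mem_cat => /orP [/cI|/dI].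
  - exists [seq (a * p.1, p.2) | p <- c]; split.
      by move=> _ /mapP [p pc ->]; apply: (cI p).
    by rewrite big_map big_distrr /=; apply: eq_bigr => p _; rewrite mulrA.
have [t It nqt] := Iq q; exists (g t) => //; exists [:: (1, t)].
by split=> [p|]; rewrite ?big_seq1 ?mul1r // inE => /eqP ->.
Qed.

(* For an epimorphism, the first clause says that each element of B is a
   fraction locally on Spec B; the second one is flatness. *)
Definition flat_epi : Prop :=
  (forall b, covers [set t | exists r, g t * b = g r]) /\
  (forall a, g a = 0 -> covers [set t | t * a = 0]).

(* B becomes the localization of A at T after inverting T. *)
Definition local_along (T : set A) : Prop :=
  [/\ mult_set T, forall b, exists2 t, T t & exists r, g t * b = g r
    & forall a, g a = 0 -> exists2 t, T t & t * a = 0].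

End Covers.

(** * Open immersions at a point *)

Section OpenImmersion.
Local Open Scope classical_set_scope.
Context {A B : comPzRingType} (f : {rmorphism A -> B}).
Hypothesis f_open : open_immersion f.

(** If [b] in [q'] were outside [q], the image of the open set D(b) would be relatively open and
    contain [f^-1 q], hence its generization [f^-1 q']; injectivity would put [q'] in D(b). *)
Lemma spec_map_specialization (q q' : spec B) :
  spec_map f q' `<=` spec_map f q -> q' `<=` q.
Proof.
have [[finj _ _ fop] _] := f_open.
move=> sqq' b q'b; apply: contrapT => nqb.
have [O /spec_openE [E ->] WO] := fop (zariski_open [set b])
  ((spec_openE _).2 (ex_intro _ _ erefl)).
have : (spec_map f @` zariski_open [set b]) (spec_map f q).
  by exists q => // sb; apply/nqb/sb.
rewrite WO => -[nE _].
have : (spec_map f @` zariski_open [set b]) (spec_map f q').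
  by rewrite WO; split; [move=> sE; apply: nE => x /sE /sqq'|exists q'].
case=> q'' nb /finj q''q'; apply: nb => _ ->.
by rewrite q''q'.
Qed.

Lemma open_immersion_local (q : spec B) :
  local_along f [set t | ~ spec_set q (f t)].
Proof.
have [_ /(_ q) [stalk_inj stalk_surj]] := f_open.
have [nq1 nqM] := mult_set_not_prime q.
have mT : mult_set [set t | ~ spec_set q (f t)].
  by split=> [|x y qx qy]; rewrite /= ?rmorph1 // rmorphM; apply: nqM.
split=> // [b|a fa0].
- have [[a s] /= qs [u nqu /= ub]] := stalk_surj (b, 1) nq1.
  (* The factor [u] from the stalk has a multiple of the form [f t] with [t] not vanishing at [q].
     Otherwise some prime [q'] contains [u] and avoids all these [f t]; then [f^-1 q'] lies in
     [f^-1 q], so [q'] lies in [q] and [u] is in [q]. *)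
  pose J := [set x | exists c, x = c * u].
  have [x [c ->] [t nqt ftx]] : exists2 x, J x & exists2 t, ~ spec_set q (f t) & f t = x.
    apply: contrapT => nJ.
    have [|||q' uq' q'T] := @prime_avoiding B J
      [set f t | t in [set t | ~ spec_set q (f t)]].
    + split=> [|_ _ [c ->] [d ->]|a' _ [c ->]].
      * by exists 0; rewrite mul0r.
      * by exists (c + d); rewrite mulrDl.
      * by exists (a' * c); rewrite mulrA.
    + have [T1 TM] := mT; split; first by exists 1; rewrite ?rmorph1.
      move=> _ _ [x nx <-] [y ny <-]; exists (x * y); last exact: rmorphM.
      exact: TM.
    + by move=> x Jx [t nqt ftx]; apply: nJ; exists x => //; exists t.
    + apply/nqu/(@spec_map_specialization q q').
        move=> t q't; apply: contrapT => nqt.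
        by apply: (q'T _ q't); exists t.
      by apply: uq'; exists 1; rewrite mul1r.
  exists (t * s); first by case: mT => _; apply.
  exists (t * a); rewrite !rmorphM ftx; apply/eqP; rewrite -subr_eq0; apply/eqP.
  rewrite mulr1 in ub.
  have -> : c * u * f s * b - c * u * f a = - (c * (u * (f a - b * f s))) by ring.
  by rewrite ub mulr0 oppr0.
- have [|||t /= nt] := stalk_inj (a, 1) (0, 1).
  + by rewrite /fractions /= rmorph1.
  + by rewrite /fractions /= rmorph1.
  + by exists 1 => //=; rewrite fa0 rmorph0 mul0r subrr mulr0.
  + by rewrite mulr1 mul0r subr0 => ta; exists t.
Qed.

End OpenImmersion.

(** * The kernel of [m |-> 1 (x) m] *)

Section Torsion.
Local Open Scope classical_set_scope.
Context {A B : comPzRingType} (g : {rmorphism A -> B}) (T : set A).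
Hypothesis gT : local_along g T.
Variable M : lmodType A.

(* m represents t * s: each b of s is replaced by some r with g t * b = g r *)
Fixpoint numerator (t : A) (s : seq (B * M)) (m : M) : Prop :=
  if s is (b, x) :: s' then
    exists r m', [/\ g t * b = g r, m = r *: x + m' & numerator t s' m']
  else m = 0.

Lemma numerator_scale a t s m :
  numerator t s m -> numerator (a * t) s (a *: m).
Proof.
elim: s m => [m ->|[b x] s IHs m [r [m' [tb -> /IHs sm']]]] /=.
  by rewrite scaler0.
exists (a * r), (a *: m'); split => //; last by rewrite scalerDr scalerA.
by rewrite !rmorphM -mulrA tb.
Qed.

Lemma numerator_cat t s s' m : numerator t (s ++ s') m <->
  exists m1 m2, [/\ m = m1 + m2, numerator t s m1 & numerator t s' m2].
Proof.
elim: s m => [m|[b x] s IHs m] /=.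
  split=> [sm|[m1 [m2 [-> -> sm]]]]; last by rewrite add0r.
  by exists 0, m; rewrite add0r.
split=> [[r [m' [tb -> /IHs [m1 [m2 [-> sm1 sm2]]]]]]|].
  exists (r *: x + m1), m2; rewrite addrA; split => //.
  by exists r, m1.
move=> [m1 [m2 [-> [r [m' [tb -> sm']]] sm2]]].
exists r, (m' + m2); rewrite addrA; split => //.
by apply/IHs; exists m', m2.
Qed.

Lemma numerator1 t b x m :
  numerator t [:: (b, x)] m <-> exists2 r, g t * b = g r & m = r *: x.
Proof.
split=> [[r [_ [tb -> ->]]]|[r tb ->]]; first by exists r; rewrite ?addr0.
by exists r, 0; rewrite addr0.
Qed.

Lemma local_eq r r' : g r = g r' -> exists2 t, T t & t * r = t * r'.
Proof.
case: gT => _ _ gK /eqP; rewrite -subr_eq0 -rmorphB => /eqP/gK [t Tt].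
by rewrite mulrBr => /eqP; rewrite subr_eq0 => /eqP; exists t.
Qed.

Let carried s s' := forall t m, T t -> numerator t s m ->
  exists2 a, T a & numerator (a * t) s' (a *: m).

(** Induction on the congruence, in both directions because of symmetry. For given [t] and list,
    numerators are unique only up to torsion, so a change of representative costs a factor [a] in
    [T]. *)
Lemma tens_rel_carried s s' : tens_rel g s s' -> carried s s' /\ carried s' s.
Proof.
have [[T1 TM] gF gK] := gT.
elim=> {s s'}.
- by move=> s; split=> t m Tt sm; exists 1; rewrite ?mul1r ?scale1r.
- by move=> s s' _ [].
- move=> s1 s2 s3 _ [H12 H21] _ [H23 H32]; split=> t m Tt sm.
  + have [a Ta /(H23 _ _ (TM _ _ Ta Tt)) [b Tb sbm]] := H12 _ _ Tt sm.
    by exists (b * a); [exact: TM|rewrite -mulrA -scalerA].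
  + have [a Ta /(H21 _ _ (TM _ _ Ta Tt)) [b Tb sbm]] := H32 _ _ Tt sm.
    by exists (b * a); [exact: TM|rewrite -mulrA -scalerA].
- suff catP s1 s1' s2 s2' : carried s1 s1' -> carried s2 s2' ->
      carried (s1 ++ s2) (s1' ++ s2').
    by move=> s1 s1' s2 s2' _ [? ?] _ [? ?]; split; apply: catP.
  move=> H1 H2 t _ Tt /numerator_cat [m1 [m2 [-> sm1 sm2]]].
  have [a Ta am1] := H1 _ _ Tt sm1; have [b Tb bm2] := H2 _ _ Tt sm2.
  exists (b * a); first exact: TM.
  apply/numerator_cat; exists ((b * a) *: m1), ((b * a) *: m2).
  rewrite scalerDr; split => //.
    by rewrite -mulrA -scalerA; apply: numerator_scale.
  by rewrite (mulrC b) -mulrA -scalerA; apply: numerator_scale.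
- suff catC s1 s2 : carried (s1 ++ s2) (s2 ++ s1) by move=> s1 s2; split.
  move=> t _ Tt /numerator_cat [m1 [m2 [-> sm1 sm2]]].
  exists 1; rewrite // mul1r scale1r.
  by apply/numerator_cat; exists m2, m1; rewrite addrC.
- move=> x; split=> t m Tt.
  + move=> /numerator1 [r]; rewrite mulr0 => /esym /gK [a Ta ar0] ->.
    by exists a; rewrite //= scalerA ar0 scale0r.
  + move=> -> ; exists 1 => //; apply/numerator1; exists 0.
      by rewrite mulr0 rmorph0.
    by rewrite scaler0 scale0r.
- move=> b b' x; split=> t m Tt.
  + move=> /numerator1 [r tr ->]; have [u Tu [r1 ub]] := gF b.
    have [u' Tu' [r2 ub']] := gF b'.
    have [|v Tv vE] := @local_eq (t * (u' * r1 + u * r2)) (u * u' * r).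
      rewrite !(rmorphM, rmorphD) -ub -ub' -tr; ring.
    exists (v * (u * u')); first by apply: (TM) => //; apply: TM.
    rewrite scalerA -[v * _ * r]mulrA -vE.
    exists (v * u' * r1 * t), ((v * u * r2 * t) *: x); split.
    * by rewrite !rmorphM -ub; ring.
    * by rewrite -scalerDl; congr (_ *: _); ring.
    * apply/numerator1; exists (v * u * r2 * t) => //.
      by rewrite !rmorphM -ub'; ring.
  + move=> [r1 [m' [tb -> /numerator1 [r2 tb' ->]]]].
    exists 1; rewrite // mul1r scale1r; apply/numerator1; exists (r1 + r2).
      by rewrite mulrDr tb tb' rmorphD.
    by rewrite scalerDl.
- move=> b x x'; split=> t m Tt.
  + move=> /numerator1 [r tb ->]; exists 1; rewrite // mul1r scale1r.
    exists r, (r *: x'); rewrite scalerDr; split => //.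
    by apply/numerator1; exists r.
  + move=> [r1 [m' [tb -> /numerator1 [r2 tb' ->]]]].
    have [|v Tv vE] := @local_eq r1 r2; first by rewrite -tb.
    exists v => //; apply/numerator1; exists (v * r1).
      by rewrite !rmorphM -mulrA tb.
    by rewrite scalerDr !scalerA -vE -scalerDr.
- move=> b a x; split=> t m Tt /numerator1 [r tb ->].
  + have [u Tu [r1 ub]] := gF b.
    have [|v Tv vE] := @local_eq (t * r1 * a) (u * r).
      by rewrite !rmorphM -ub -tb; ring.
    exists (v * u); first exact: TM.
    apply/numerator1; exists (v * t * r1).
      by rewrite !rmorphM -ub; ring.
    by rewrite !scalerA -[v * _ * r]mulrA -vE !mulrA.
  + exists 1; rewrite // mul1r scale1r; apply/numerator1; exists (r * a).
      by rewrite mulrA tb rmorphM.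
    by rewrite scalerA.
Qed.

(** [m] is a numerator of [[:: (1, m)]] at [t = 1]; carried over to the empty list, it becomes a
    multiple of [m] that has to be 0. *)
Lemma tens1_eq0 (m : M) : tens g 1 m = 0 -> exists2 t, T t & t *: m = 0.
Proof.
move=> /(iffRL (formalP _ _ _)) /tens_rel_carried [H _].
have [[T1 TM] _ _] := gT; have [|t Tt tm] := H 1 m T1; last by exists t.
by apply/numerator1; exists 1; rewrite ?mulr1 ?scale1r.
Qed.

End Torsion.

(** * Localization after base change to [C] *)

Section BaseChangeLocal.
Local Open Scope classical_set_scope.
Context {A B C : comPzRingType} (f : {rmorphism A -> B}) (g : {rmorphism A -> C}).

Lemma ta_inr_fraction T : local_along f T -> forall x : tensor_alg f g,
  exists2 t, T t & exists c, ta_inr f g (g t) * x = ta_inr f g c.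
Proof.
move=> [[T1 TM] fF _] x; elim/(@atens_ind A B C f g): x => [|b c|x y].
- by exists 1 => //; exists 0; rewrite mulr0 rmorph0.
- have [t Tt [r tb]] := fF b; exists t => //; exists (g r * c).
  by rewrite ta_inr_struct /ta_struct atensM mul1r tb -[f r]mul1r atens_bal.
- move=> [t Tt [c tx]] [u Tu [d uy]]; exists (t * u); first exact: TM.
  exists (g u * c + g t * d); rewrite !rmorphM [RHS]rmorphD !rmorphM /= -tx -uy; ring.
Qed.

Lemma ta_inr_local T : local_along f T ->
  local_along (ta_inr f g) [set g t | t in T].
Proof.
move=> fT; have [[T1 TM] _ _] := fT; split.
- split=> [|_ _ [t Tt <-] [u Tu <-]]; first by exists 1; rewrite ?rmorph1.
  by exists (t * u); [exact: TM|rewrite rmorphM].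
- move=> x; have [t Tt tx] := ta_inr_fraction fT x.
  by exists (g t) => //; exists t.
- move=> c /(@tens1_eq0 _ _ f T fT (restr g)) [t Tt tc].
  by exists (g t) => //; exists t.
Qed.

(** A relation [sum s_i f(t_i) = 1] in B yields one in [tensor_alg f g] with coefficients
    [s_i (x) 1], since [f t (x) 1 = 1 (x) g t]; so it suffices to test points of Spec B. *)
Lemma ta_inr_flat_epi : (forall q : spec B, local_along f [set t | ~ spec_set q (f t)]) ->
  flat_epi (ta_inr f g).
Proof.
move=> fl; have cov I : (forall q : spec B, exists2 t, I (g t) & ~ spec_set q (f t)) ->
    covers (ta_inr f g) I.
  move=> /(@covers_local _ _ f (g @^-1` I)) [c [cI c1]].
  exists [seq (atens f g p.1 1, g p.2) | p <- c]; split.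
    by move=> _ /mapP [p pc ->]; apply: cI.
  have -> : 1 = atens f g (\sum_(p <- c) p.1 * f p.2) 1 by rewrite c1.
  rewrite big_map; elim: c {cI c1} => [|p c IHc]; first by rewrite !big_nil [RHS]tens0l.
  rewrite !big_cons IHc atensDl; congr (_ + _) => /=.
  by rewrite ta_inr_struct /ta_struct atensM mulr1.
split=> [x|c gc0]; apply: cov => q.
- have [t qt [c tx]] := ta_inr_fraction (fl q) x.
  by exists t => //; exists c.
- by have [_ _ /(_ c gc0) [_ [t qt <-] tc]] := ta_inr_local (fl q); exists t.
Qed.

End BaseChangeLocal.

(** * Extension of differential operators along flat epimorphisms *)

Lemma fraction_choice (A B : comPzRingType) (g : {rmorphism A -> B}) (b : B) :
  {rho : A -> A & forall t,
    (exists r, g t * b = g r) -> g t * b = g (rho t)}.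
Proof.
apply: (choice (P := fun t s => (exists r, g t * b = g r) -> g t * b = g s)).
move=> t; have [[r tb]|nt] := pselect (exists r, g t * b = g r).
  by exists r.
(* Default value when [t] is not a denominator of [b]. *)
by exists 0 => /nt.
Qed.

(** * Commuting operators on maps, and nilpotence *)

Section Bioperators.
Context {A B : comPzRingType} (g : {rmorphism A -> B}).
Context {M : lmodType A} {W : lmodType B}.
Implicit Types (e : M -> W) (F G : (M -> W) -> M -> W).

Definition lact (b : B) e : M -> W := fun x => b *: e x.
Definition ract (a : A) e : M -> W := fun x => e (a *: x).

(* the action of the commutative ring B (x) A on the bimodule of maps M -> W *)
Inductive biop : ((M -> W) -> M -> W) -> Prop :=
| BiopL b : biop (lact b)
| BiopR a : biop (ract a)
| BiopD F G : biop F -> biop G -> biop (fun e => F e + G e)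
| BiopM F G : biop F -> biop G -> biop (fun e => F (G e)).

(** This is [theta] for maps into a B-module, written with the two actions so that it is a [biop];
    [g = idfun] gives [theta] back. *)
Definition dtheta (a : A) e : M -> W := lact (g a) e - ract a e.

Lemma biop_ext F G : F =1 G -> biop F -> biop G.
Proof. by move=> /funext ->. Qed.

Lemma biopN F : biop F -> biop (fun e => - F e).
Proof.
move=> bF; apply: (biop_ext _ (BiopM (BiopL (-1)) bF)) => e.
by apply/funext => x; rewrite /lact scaleN1r.
Qed.

Lemma biop_dtheta a : biop (dtheta a).
Proof. exact: BiopD (BiopL _) (biopN (BiopR a)). Qed.

Lemma biop_sum J (s : seq J) (F : J -> (M -> W) -> M -> W) :
  (forall j, biop (F j)) -> biop (fun e => \sum_(j <- s) F j e).
Proof.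
move=> bF; elim: s => [|j s IHs].
  apply: (biop_ext _ (BiopL 0)) => e; rewrite big_nil.
  by apply/funext => x; rewrite /lact scale0r.
by apply: (biop_ext _ (BiopD (bF j) IHs)) => e; rewrite big_cons.
Qed.

Lemma biop_iter F n : biop F -> biop (iter n F).
Proof.
move=> bF; elim: n => [|n IHn]; last exact: BiopM.
by apply: (biop_ext _ (BiopL 1)) => e; apply/funext => x; rewrite /lact scale1r.
Qed.

Lemma biop_add F e e' : biop F -> F (e + e') = F e + F e'.
Proof.
move=> bF; elim: bF e e' => {F} [b|a|F G _ IHF _ IHG|F G _ IHF _ IHG] e e'.
- by apply/funext => x; apply: scalerDr.
- by [].
- by rewrite IHF IHG addrACA.
- by rewrite IHG IHF.
Qed.

Lemma biop0 F : biop F -> F 0 = 0.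
Proof. by move=> bF; apply: (addrI (F 0)); rewrite -biop_add // !addr0. Qed.

Lemma biop_opp F e : biop F -> F (- e) = - F e.
Proof.
by move=> bF; apply: (addrI (F e)); rewrite -biop_add // !subrr biop0.
Qed.

Lemma biop_sub F e e' : biop F -> F (e - e') = F e - F e'.
Proof. by move=> bF; rewrite biop_add // biop_opp. Qed.

(** The generators commute because A and B are commutative; induction on each operator extends
    this. *)
Lemma biopC F G e : biop F -> biop G -> F (G e) = G (F e).
Proof.
have gen H : biop H -> (forall b e, H (lact b e) = lact b (H e)) /\
    (forall a e, H (ract a e) = ract a (H e)).
  elim=> {H} [b|a|H H' _ [HL HR] _ [HL' HR']|H H' _ [HL HR] _ [HL' HR']];
    split=> c e'.
  - by apply/funext => x; rewrite /lact !scalerA mulrC.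
  - by [].
  - by [].
  - by apply/funext => x; rewrite /ract !scalerA mulrC.
  - by rewrite HL HL' -biop_add //; apply: BiopL.
  - by rewrite HR HR'.
  - by rewrite HL' HL.
  - by rewrite HR' HR.
move=> bF bG; elim: bF e => {F} [b|a|F F' bF IHF bF' IHF'|F F' bF IHF bF' IHF'] e.
- by have [-> _] := gen _ bG.
- by have [_ ->] := gen _ bG.
- by rewrite IHF IHF' -biop_add.
- by rewrite IHF' IHF.
Qed.

Lemma biop_iterC F G n e : biop F -> biop G -> iter n F (G e) = G (iter n F e).
Proof. by move=> bF bG; apply: biopC => //; apply: biop_iter. Qed.

Lemma biop_additive F e : biop F ->
  {morph e : x y / x + y} -> {morph F e : x y / x + y}.
Proof.
move=> bF; elim: bF e => {F} [b|a|F G _ IHF _ IHG|F G _ IHF _ IHG] e eD x y.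
- by rewrite /lact eD scalerDr.
- by rewrite /ract scalerDr eD.
- by rewrite !addrfctE IHF // IHG // addrACA.
- by apply: IHF => *; apply: IHG.
Qed.

Definition nilpotent_at F e := exists n, iter n F e = 0.

Lemma iter_zero F e n m : biop F -> iter n F e = 0 -> iter (m + n) F e = 0.
Proof. by move=> bF Fe; rewrite iterD Fe; apply/biop0/biop_iter. Qed.

Lemma nilpotent_biop F G e : biop F -> biop G ->
  nilpotent_at F e -> nilpotent_at F (G e).
Proof.
by move=> bF bG [n Fe]; exists n; rewrite biop_iterC // Fe biop0.
Qed.

Lemma nilpotent_atD F e e' : biop F ->
  nilpotent_at F e -> nilpotent_at F e' -> nilpotent_at F (e + e').
Proof.
move=> bF [n Fe] [m Fe']; exists (m + n)%N; rewrite (biop_add _ _ (biop_iter _ bF)).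
by rewrite iter_zero // addnC iter_zero // addr0.
Qed.

(** Double induction in place of the binomial formula: as [F] and [G] commute, [F e] has a smaller
    exponent for [F], and [G e] a smaller one for [G]. *)
Lemma nilpotentD F G e : biop F -> biop G ->
  nilpotent_at F e -> nilpotent_at G e -> nilpotent_at (fun e => F e + G e) e.
Proof.
move=> bF bG [n Fe] [m Ge]; exists (n + m)%N.
have bFG := BiopD bF bG.
elim: n m e Fe Ge => [|n IHn] m e Fe Ge.
  by rewrite (_ : e = 0) //; apply/biop0/biop_iter.
elim: m e Fe Ge => [|m IHm] e Fe Ge.
  by rewrite (_ : e = 0) //; apply/biop0/biop_iter.
rewrite addSn iterSr (biop_add _ _ (biop_iter _ bFG)).
rewrite IHn ?add0r.
- rewrite -addSnnS IHm //; first by rewrite biop_iterC // Fe biop0.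
  by rewrite -iterSr.
- by rewrite -iterSr.
- by rewrite biop_iterC // Ge biop0.
Qed.

Lemma nilpotentM F G e : biop F -> biop G ->
  nilpotent_at G e -> nilpotent_at (fun e => F (G e)) e.
Proof.
move=> bF bG [n Ge]; exists n.
have -> : iter n (fun e => F (G e)) e = iter n F (iter n G e).
  elim: n {Ge} => [//|n IHn]; rewrite !iterS IHn -(biopC _ (biop_iter n bF) bG).
  by rewrite -iterS.
by rewrite Ge; apply/biop0/biop_iter.
Qed.

Lemma nilpotent_sum J (s : seq J) (F : J -> (M -> W) -> M -> W) e :
  (forall j, biop (F j)) -> (forall j, nilpotent_at (F j) e) ->
  nilpotent_at (fun e => \sum_(j <- s) F j e) e.
Proof.
move=> bF nF; elim: s => [|j s IHs].
  by exists 1%N; rewrite /= big_nil.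
rewrite (_ : (fun e => _) = fun e => F j e + \sum_(j <- s) F j e).
  exact: nilpotentD (biop_sum _ _) _ _.
by apply/funext => e'; rewrite big_cons.
Qed.

End Bioperators.

(** * Right multiplication of differential operators by [B] *)

Section Extension.
Context {K A B : comPzRingType} (i : {rmorphism K -> A}) (g : {rmorphism A -> B}).
Context {M : lmodType A} {W : lmodType B}.
Implicit Types (e : M -> W).

(* [diff_op] with values in a module over the A-algebra B; K-linearity over
   additivity says that dtheta (i kappa) vanishes. *)
Definition diffop_into e : Prop :=
  [/\ {morph e : x y / x + y}, forall kappa, dtheta g (i kappa) e = 0
    & forall a, nilpotent_at (dtheta g a) e].

Lemma biop_diffop F e : biop F -> diffop_into e -> diffop_into (F e).
Proof.
move=> bF [eD eK en]; split.
- exact: biop_additive.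
- by move=> kappa; rewrite (biopC _ (biop_dtheta _ _)) // eK biop0.
- by move=> a; apply: nilpotent_biop => //; apply: biop_dtheta.
Qed.

Lemma diffop_add e e' : diffop_into e -> diffop_into e' -> diffop_into (e + e').
Proof.
move=> [eD eK en] [eD' eK' en']; split.
- by move=> x y; rewrite !addrfctE eD eD' addrACA.
- by move=> kappa; rewrite (biop_add _ _ (biop_dtheta _ _)) eK eK' addr0.
- by move=> a; apply: nilpotent_atD => //; apply: biop_dtheta.
Qed.

Lemma diffop_sub e e' : diffop_into e -> diffop_into e' -> diffop_into (e - e').
Proof.
move=> De De'; apply: diffop_add => //.
have -> : - e' = lact (-1) e' by apply/funext => x; rewrite /lact scaleN1r.
exact: biop_diffop (BiopL _) De'.
Qed.

Section Cover.
Variable c : seq (B * A).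
Hypothesis c1 : \sum_(p <- c) p.1 * g p.2 = 1.

Let C e : M -> W := \sum_(p <- c) lact p.1 (ract p.2 e).
Let N e : M -> W := \sum_(p <- c) lact p.1 (dtheta g p.2 e).

Let bC : biop C.
Proof. by apply: biop_sum => p; apply: BiopM (BiopL _) (BiopR _). Qed.

Let bN : biop N.
Proof. by apply: biop_sum => p; apply: BiopM (BiopL _) (biop_dtheta _ _). Qed.

Let nN e : diffop_into e -> nilpotent_at N e.
Proof.
move=> [_ _ en]; apply: nilpotent_sum => p.
  exact: BiopM (BiopL _) (biop_dtheta _ _).
exact: nilpotentM (BiopL _) (biop_dtheta _ _) _.
Qed.

(* sum of s_i t_i = 1 with the t_i acting on the left; moving them to the right
   costs the nilpotent operator N, so C is invertible on e. *)
Let CN e : C e + N e = e.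
Proof.
apply/funext => x; rewrite addrfctE /C /N !fct_sumE -big_split /=.
rewrite -[RHS]scale1r -c1 scaler_suml; apply: eq_bigr => p _.
by rewrite /lact /dtheta /ract !fctE scalerBr addrC subrK scalerA.
Qed.

(** When the [e t_i] vanish so does [C e], hence [N e = e], and nilpotence of [N] at [e] gives
    [e = 0]. *)
Lemma diffop_cover_eq0 e : diffop_into e -> {in c, forall p, ract p.2 e = 0} ->
  e = 0.
Proof.
move=> De ce; have [n Ne] := nN De.
have Ce : C e = 0.
  rewrite /C big_seq big1 // => p pc; rewrite ce // biop0 //; exact: BiopL.
have NE : N e = e by rewrite -[RHS]CN Ce add0r.
by rewrite -Ne; elim: n {Ne} => [//|n /= <-]; rewrite NE.
Qed.

(** On [e], [C = 1 - N] is inverted by a finite geometric series in [N], built by induction: if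
    [N e = C (P (N e))], then [e = C e + N e = C (e + P (N e))]. *)
Lemma diffop_cover_surj e : diffop_into e -> exists2 h, diffop_into h &
  e = \sum_(p <- c) lact p.1 (ract p.2 h).
Proof.
move=> De; have [n Ne] := nN De.
suff [P bP Pe] : exists2 P, biop P & e = C (P e).
  by exists (P e) => //; exact: biop_diffop.
elim: n e {De} Ne => [e /= ->|n IHn e].
  by exists (@lact _ _ M W 0); [exact: BiopL|rewrite !biop0 //; exact: BiopL].
rewrite iterSr => /IHn [P bP Pe]; exists (fun e => e + P (N e)).
  apply: BiopD; last exact: BiopM.
  by apply: (biop_ext _ (BiopL 1)) => e'; apply/funext => x; rewrite /lact scale1r.
by rewrite biop_add // -Pe CN.
Qed.

End Cover.

Hypothesis g_epi : flat_epi g.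

(** Flatness covers Spec B by elements [t] with [t * a = 0], and right multiplication by these kills
    [ract a e]. *)
Lemma diffop_ract_ker e a : diffop_into e -> g a = 0 -> ract a e = 0.
Proof.
move=> De /(g_epi.2) [c [cI c1]].
apply: (diffop_cover_eq0 c1); first exact: biop_diffop (BiopR _) De.
move=> p /cI pa; apply/funext => x; rewrite /ract scalerA mulrC pa scale0r.
by have [eD _ _] := De; apply: (addrI (e 0)); rewrite -eD !addr0.
Qed.

Lemma diffop_ract_eq e a a' : diffop_into e -> g a = g a' -> ract a e = ract a' e.
Proof.
move=> De /eqP; rewrite -subr_eq0 -rmorphB => /eqP/(diffop_ract_ker De) eB.
apply/funext => x; have [eD _ _] := De.
have : ract (a - a' + a') e x = ract (a - a') e x + ract a' e x.
  by rewrite /ract scalerDl eD.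
by rewrite subrK eB add0r.
Qed.

(* e * b for the right action of B which extends that of A: [b] is a fraction
   r / t on a cover, so e * b is determined by (e * b) t = e r. *)
Definition frac_act e (b : B) e' : Prop :=
  diffop_into e' /\ forall t r, g t * b = g r -> ract t e' = ract r e.

Lemma frac_act_ex e b : diffop_into e -> exists e', frac_act e b e'.
Proof.
move=> De; have [c [cI c1]] := g_epi.1 b.
have [h Dh eh] := diffop_cover_surj c1 De.
have [rho rhoP] := fraction_choice g b.
have bG : biop (fun e : M -> W => \sum_(p <- c) lact p.1 (ract (rho p.2) e)).
  by apply: biop_sum => p; apply: BiopM (BiopL _) (BiopR _).
exists (\sum_(p <- c) lact p.1 (ract (rho p.2) h)); split.
  exact: biop_diffop bG Dh.
move=> t r tb; rewrite -(biopC h bG (BiopR t)) eh.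
rewrite -(biopC h (biop_sum _ (fun p => BiopM (BiopL _) (BiopR _))) (BiopR r)).
(* With [t_i = p.2] and [r_i = rho t_i], both [t * r_i] and [r * t_i] map to [g t * g t_i * b], so
   they act alike on [h]. *)
rewrite big_seq [RHS]big_seq; apply: eq_bigr => p /cI /rhoP pb; congr lact.
have -> : ract (rho p.2) (ract t h) = ract (t * rho p.2) h.
  by apply/funext => x; rewrite /ract scalerA.
have -> : ract p.2 (ract r h) = ract (r * p.2) h.
  by apply/funext => x; rewrite /ract scalerA.
apply: diffop_ract_eq => //; rewrite !rmorphM -pb -tb; ring.
Qed.

(** The denominators of [b] cover Spec B. Identities for [act] can thus be tested after right
    multiplication by denominators, where only the action of A on [e] remains. *)
Lemma frac_eq0 e b : diffop_into e ->
  (forall t r, g t * b = g r -> ract t e = 0) -> e = 0.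
Proof.
move=> De e0; have [c [cI c1]] := g_epi.1 b.
by apply: (diffop_cover_eq0 c1) => // p /cI [r]; apply: e0.
Qed.

Section Act.
Variables (e : M -> W) (act : B -> M -> W).
Hypotheses (De : diffop_into e) (actP : forall b, frac_act e b (act b)).

Lemma act1 : act 1 = e.
Proof.
have [_ /(_ 1 1)] := actP 1; rewrite !mulr1 => /(_ erefl) E.
by apply/funext => x; have := congr1 (@^~ x) E; rewrite /ract scale1r.
Qed.

Lemma actD b b' : act (b + b') = act b + act b'.
Proof.
have [eD _ _] := De.
have [Db bE] := actP b; have [Db' bE'] := actP b'; have [DD DE] := actP (b + b').
have Ddiff := diffop_sub DD (diffop_add Db Db').
apply/eqP; rewrite -subr_eq0; apply/eqP.
(* With [b = r / t] and [b' = s / u], right multiplication by [t * u] reduces the claim to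
   [e (u r + t s) = e (u r) + e (t s)]. *)
apply: (frac_eq0 (b := b)) => // t r tb.
apply: (frac_eq0 (b := b')); first exact: biop_diffop (BiopR _) Ddiff.
move=> u s ub'.
have -> : ract u (ract t (act (b + b') - (act b + act b'))) =
    ract (t * u) (act (b + b') - (act b + act b')).
  by apply/funext => x; rewrite /ract scalerA.
rewrite (biop_sub _ _ (BiopR _)) (biop_add _ _ (BiopR _)).
rewrite (DE _ (u * r + t * s)); last first.
  by rewrite rmorphD !rmorphM -tb -ub'; ring.
rewrite (bE _ (u * r)); last by rewrite !rmorphM -tb; ring.
rewrite (bE' _ (t * s)); last by rewrite !rmorphM -ub'; ring.
apply/eqP; rewrite subr_eq0; apply/eqP/funext => x.
by rewrite /ract scalerDl eD.
Qed.

Lemma act_ract b a : act (b * g a) = ract a (act b).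
Proof.
have [Db bE] := actP b; have [Dba baE] := actP (b * g a).
have Dab := biop_diffop (BiopR a) Db.
apply/eqP; rewrite -subr_eq0; apply/eqP.
apply: (frac_eq0 (b := b)) => [|t r tb]; first exact: diffop_sub.
rewrite (biop_sub _ _ (BiopR _)) (baE _ (r * a)); last by rewrite mulrA tb rmorphM.
rewrite (biopC _ (BiopR t) (BiopR a)) (bE _ _ tb).
by apply/funext => x; rewrite addrfctE opprfctE /ract scalerA subrr.
Qed.

Lemma act_theta_eq0 b a n : iter n (dtheta g a) e = 0 ->
  iter n (dtheta g a) (act b) = 0.
Proof.
have bt := biop_iter n (@biop_dtheta _ _ g M W a).
have [Db bE] := actP b => e0.
apply: (frac_eq0 (b := b)) => [|t r tb]; first exact: biop_diffop.
by rewrite (biopC _ (BiopR t) bt) (bE _ _ tb) (biopC _ bt (BiopR r)) e0.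
Qed.

End Act.
End Extension.

(** * The operator on [B (x)_A M] *)

Section Extend.
Context {K A B : comPzRingType} (i : {rmorphism K -> A}) (g : {rmorphism A -> B}).
Context {M : lmodType A} {W : lmodType B}.

Lemma tens_map_ext (D D' : base_change g M -> W) :
  {morph D : x y / x + y} -> {morph D' : x y / x + y} ->
  (forall b m, D (tens g b m) = D' (tens g b m)) -> D = D'.
Proof.
have map0 (F : base_change g M -> W) : {morph F : x y / x + y} -> F 0 = 0.
  by move=> FD; apply: (addrI (F 0)); rewrite -FD !addr0.
move=> DD DD' E; apply/funext => x; elim/(@tens_ind _ _ g M): x => [|b m|x y IHx IHy].
- by rewrite !map0.
- exact: E.
- by rewrite DD DD' IHx IHy.
Qed.

(* From t b = r: the commutators satisfy t [b] = [r] - [t] b. *)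
Lemma dtheta_fraction (D : base_change g M -> W) b t r : g t * b = g r ->
  lact (g t) (dtheta idfun b D) =
  dtheta idfun (g r) D - ract b (dtheta idfun (g t) D).
Proof.
move=> tb; apply/funext => x; rewrite /dtheta /lact /ract !fctE /=.
by rewrite -tb scalerA mulrC scalerBr !scalerA (mulrC b) opprB addrA addrNK.
Qed.

(** Commutators of [D] with [g a] are commutators of each [act b] with [a], with the same exponent
    as for [e]. For arbitrary [b] in B, the commutator is a sum over a cover of operators nilpotent
    at [D]. *)
Lemma diffop_extension (e : M -> W) : flat_epi g -> diffop_into i g e ->
  exists D : base_change g M -> W,
    diffop_into (g \o i) idfun D /\ forall m, D (tens g 1 m) = e m.
Proof.
move=> g_epi De; have [act actP] := choice (fun b => frac_act_ex g_epi b De).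
have bal : balanced g act.
  split=> [b b' m|b m m'|b a m].
  - by rewrite (actD g_epi De actP).
  - by have [[+ _ _] _] := actP b; apply.
  - by rewrite (act_ract g_epi actP).
pose D : base_change g M -> W := tens_lift g act.
have DE b m : D (tens g b m) = act b m by apply: tens_liftE.
have DD : {morph D : x y / x + y} by move=> x y; apply: (tens_liftD bal).
have thetaD a n b m : iter n (dtheta idfun (g a)) D (tens g b m) =
    iter n (dtheta g a) (act b) m.
  elim: n b m => [|n IHn] b m; first exact: DE.
  rewrite !iterS {1}/dtheta {2}/dtheta /lact /ract !fctE /= scale_tens !IHn.
  rewrite mulrC (act_ract g_epi actP).
  by rewrite (biop_iterC _ _ (biop_dtheta _ _) (BiopR a)).
have theta0 a n : iter n (dtheta g a) e = 0 -> iter n (dtheta idfun (g a)) D = 0.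
  move=> e0; apply: tens_map_ext => [||b m].
  - exact: biop_additive (biop_iter n (biop_dtheta _ _)) DD.
  - by move=> x y; rewrite addr0.
  - by rewrite thetaD (act_theta_eq0 g_epi actP).
have [eD eK en] := De.
exists D; split=> [|m]; last by rewrite DE (act1 actP).
(* K-linearity is the case of exponent 1. *)
split=> // [kappa|b]; first by apply: (theta0 _ 1%N); apply: eK.
have nD a : nilpotent_at (dtheta idfun (g a)) D.
  by have [n /theta0] := en a; exists n.
have [c [cI c1]] := g_epi.1 b.
have [rho rhoP] := fraction_choice g b.
pose F (p : B * A) (D' : base_change g M -> W) := lact p.1
  (dtheta idfun (g (rho p.2)) D' + - ract b (dtheta idfun (g p.2) D')).
have bF2 p : biop (fun D' : base_change g M -> W =>
    - ract b (dtheta idfun (g p) D')).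
  exact: biopN (BiopM (BiopR _) (biop_dtheta _ _)).
have bF p : biop (F p).
  exact: BiopM (BiopL _) (BiopD (biop_dtheta _ _) (bF2 _)).
have -> : dtheta idfun b = fun D' => \sum_(p <- c) F p D'.
  apply/funext => D'; apply: (@etrans _ _ (lact 1 (dtheta idfun b D'))).
    by apply/funext => x; rewrite /lact scale1r.
  rewrite -c1; apply: (@etrans _ _
    (\sum_(p <- c) lact p.1 (lact (g p.2) (dtheta idfun b D')))).
    apply/funext => x; rewrite fct_sumE /lact scaler_suml.
    by apply: eq_bigr => p _; rewrite scalerA.
  rewrite big_seq [RHS]big_seq; apply: eq_bigr => p /cI /rhoP pb.
  by rewrite (dtheta_fraction _ pb).
apply: nilpotent_sum => // p.
apply: (nilpotentM (G := fun D' => _) (BiopL _)).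
  exact: BiopD (biop_dtheta _ _) (bF2 _).
apply: nilpotentD => //; first exact: biop_dtheta.
exact: (nilpotentM (biopN (BiopR b)) (biop_dtheta _ _)).
Qed.

End Extend.

Lemma thetaE (A : comPzRingType) (M N : lmodType A) (a : A) :
  @theta A M N a = dtheta idfun a.
Proof. by []. Qed.

Lemma diff_opP (K A : comPzRingType) (i : {rmorphism K -> A})
  (M N : lmodType A) (D : M -> N) : diff_op i D <-> diffop_into i idfun D.
Proof.
split=> [[Dlin Dnil]|[DD DK Dnil]].
- have DD : {morph D : x y / x + y}.
    by move=> x y; have := Dlin 1 x y; rewrite rmorph1 !scale1r.
  have D0 : D 0 = 0 by apply: (addrI (D 0)); rewrite -DD !addr0.
  split=> // [kappa|a]; last first.
    by have [n Dn] := Dnil a; exists n.+1; apply/funext => x; rewrite -thetaE Dn.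
  apply/funext => x; have := Dlin kappa x 0; rewrite D0 !addr0 => E.
  by rewrite /dtheta /lact /ract !fctE /= E subrr.
- split=> [kappa x y|a].
    have := congr1 (@^~ x) (DK kappa); rewrite /dtheta /lact /ract !fctE /= => /eqP.
    by rewrite subr_eq0 => /eqP ->; rewrite DD.
  (* [diff_op] counts the exponent as [n.+1]; one more iteration still vanishes. *)
  have [n Dn] := Dnil a; exists n => x; rewrite thetaE.
  by rewrite (@iter_zero _ _ _ _ _ _ n 1 (biop_dtheta _ _) Dn).
Qed.

Lemma tens0r (A B : comPzRingType) (f : {rmorphism A -> B}) (M : lmodType A) b :
  tens f b (0 : M) = 0.
Proof. by apply: (addrI (tens f b 0)); rewrite -tensDr !addr0. Qed.

(** Commutators pass through [j] and [psi]. The case [psi = id] extends the scalars of the values;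
    the case [j = id] changes the source along the inverse of [bc_trans]. *)
Lemma diffop_comp (K A B : comPzRingType) (i : {rmorphism K -> A})
    (g : {rmorphism A -> B}) (M M' N : lmodType A)
    (W : lmodType B) (D : M -> N) (j : N -> W) (psi : M' -> M) :
  {morph j : x y / x + y} -> (forall a x, j (a *: x) = g a *: j x) ->
  {morph psi : x y / x + y} -> scalable psi ->
  diffop_into i idfun D -> diffop_into i g (j \o D \o psi).
Proof.
move=> jD jZ psiD psiZ [DD DK Dnil].
have j0 : j 0 = 0 by apply: (addrI (j 0)); rewrite -jD !addr0.
have jB x y : j (x - y) = j x - j y.
  by apply: (addIr (j y)); rewrite -jD !subrK.
have iterE n a : iter n (dtheta g a) (j \o D \o psi) =
    j \o iter n (dtheta idfun a) D \o psi.
  elim: n => [//|n IHn]; rewrite !iterS IHn; apply/funext => x.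
  by rewrite {1 3}/dtheta /lact /ract !fctE /= jB jZ psiZ.
split=> [x y|kappa|a].
- by rewrite /= psiD DD jD.
- by have := iterE 1%N (i kappa); rewrite /= DK => ->; apply/funext.
- by have [n Dn] := Dnil a; exists n; rewrite iterE Dn; apply/funext.
Qed.

(** * Induced operators under the identification [bc_trans] *)

Section InducedTrans.
Context {K A B C : comPzRingType} (k : {rmorphism K -> A}).
Context (f : {rmorphism A -> B}) (g : {rmorphism B -> C}).
Context (h : {rmorphism A -> C}) (hE : h =1 g \o f).

Lemma bc_transZ (M : lmodType A) c (x : base_change g (base_change f M)) :
  bc_trans h (c *: x) = c *: bc_trans h x.
Proof.
elim/(@tens_ind _ _ g): x => [|c' y|x y IHx IHy].
- by rewrite scaler0 (bc_trans0 hE) scaler0.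
- rewrite scale_tens; elim/(@tens_ind _ _ f M): y => [|b m|y z IHy IHz].
  + by rewrite !tens0r !(bc_trans0 hE) scaler0.
  + by rewrite !(bc_transE hE) scale_tens mulrA.
  + by rewrite !tensDr !(bc_transD hE) IHy IHz scalerDr.
- by rewrite scalerDr !(bc_transD hE) IHx IHy scalerDr.
Qed.

Variable (M N : lmodType A).

Lemma tens1D (x y : base_change f N) :
  bc_trans h (tens g 1 (x + y)) = bc_trans h (tens g 1 x) + bc_trans h (tens g 1 y).
Proof. by rewrite tensDr (bc_transD hE). Qed.

Lemma tens1Z b (x : base_change f N) :
  bc_trans h (tens g 1 (b *: x)) = g b *: bc_trans h (tens g 1 x).
Proof. by rewrite -tens_bal mul1r -[g b]mulr1 -scale_tens bc_transZ mulr1. Qed.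

(** The operator [x |-> 1 (x) D x] extends to [C (x)_B (B (x)_A M)] by [diffop_extension]; the
    inverse of [bc_trans] then moves its source to [C (x)_A M]. *)
Lemma induced_trans_ex (D : base_change f M -> base_change f N) :
  flat_epi g -> diff_op (f \o k) D ->
  exists D' : base_change h M -> base_change h N, induced_trans (h \o k) g D D'.
Proof.
move=> g_epi /diff_opP DD.
have De : diffop_into (f \o k) g (fun x => bc_trans h (tens g 1 (D x)) : base_change h N).
  exact: (@diffop_comp _ _ _ _ _ _ _ _ _ _ _ id tens1D tens1Z).
have [D1 [D1D D1E]] := diffop_extension g_epi De.
have [psi bcK psiK] := bc_trans_bij hE M.
exists (D1 \o psi); split; last by move=> x; rewrite /= bcK D1E.
apply/diff_opP.
have psiD : {morph psi : x y / x + y}.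
  by move=> x y; apply: (can_inj bcK); rewrite (bc_transD hE) !psiK.
have psiZ : scalable psi.
  by move=> c x; apply: (can_inj bcK); rewrite bc_transZ !psiK.
have := @diffop_comp _ _ _ _ idfun _ _ _ _ _ id _ (fun _ _ => erefl)
  (fun _ _ => erefl) psiD psiZ D1D.
move=> [D'D D'K D'nil]; split=> // kappa.
by rewrite /= hE; apply: D'K.
Qed.

End InducedTrans.

(** * Gluing on an affine open covering *)

Section Overlap.
Local Open Scope classical_set_scope.
Context {A B C : comPzRingType} (f : {rmorphism A -> B}) (g : {rmorphism A -> C}).
Variable V : lmodType A.

Definition to_overlap (x : base_change g V) : base_change (ta_struct f g) V :=
  bc_trans (ta_struct f g) (tens (ta_inr f g) 1 x).

Lemma to_overlapD x y : to_overlap (x + y) = to_overlap x + to_overlap y.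
Proof. exact: (tens1D (fun a => esym (ta_inr_struct f g a))). Qed.

Lemma to_overlapZ a x : to_overlap (g a *: x) = ta_struct f g a *: to_overlap x.
Proof.
rewrite -(ta_inr_struct f g).
exact: (tens1Z (fun a => esym (ta_inr_struct f g a))).
Qed.

Lemma to_overlap_tens v : to_overlap (tens g 1 v) = tens (ta_struct f g) 1 v.
Proof.
rewrite /to_overlap (bc_transE (fun a => esym (ta_inr_struct f g a))).
by rewrite rmorph1 mulr1.
Qed.

(** [ta_inr f g] is local along the image of [T], so [tens1_eq0] applies over C once the bijection
    [bc_trans] is undone. *)
Lemma to_overlap_eq0 T (x : base_change g V) : local_along f T ->
  to_overlap x = 0 -> exists2 t, T t & g t *: x = 0.
Proof.
move=> fT x0; have hE a : ta_struct f g a = ta_inr f g (g a).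
  by rewrite ta_inr_struct.
have [|_ [t Tt <-] tx] := @tens1_eq0 _ _ _ _ (ta_inr_local g fT) _ x.
  by apply: (bij_inj (bc_trans_bij hE V)); rewrite (bc_trans0 hE).
by exists t.
Qed.

Lemma ta_swap_struct x a :
  ta_swap (x * ta_struct f g a) = ta_swap x * ta_struct g f a.
Proof.
elim/(@atens_ind A B C f g): x => [|b c|x y IHx IHy].
- by rewrite mul0r /ta_swap (tens_lift0 (ta_swap_balanced f g)) mul0r.
- by rewrite (ta_structE g f) !atensM !ta_swapE atensM.
- by rewrite mulrDl !ta_swapD IHx IHy mulrDl.
Qed.

Definition overlap_swap (z : base_change (ta_struct f g) V) :
  base_change (ta_struct g f) V := bc_map (@ta_swap _ _ _ f g) z.

Lemma overlap_swapD x y : overlap_swap (x + y) = overlap_swap x + overlap_swap y.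
Proof. exact: (bc_mapD (@ta_swapD _ _ _ f g) ta_swap_struct). Qed.

Lemma overlap_swapE c v :
  overlap_swap (tens (ta_struct f g) c v) = tens (ta_struct g f) (ta_swap c) v.
Proof. exact: (bc_mapE (@ta_swapD _ _ _ f g) ta_swap_struct). Qed.

Lemma overlap_swap0 : overlap_swap 0 = 0.
Proof. by apply: (addrI (overlap_swap 0)); rewrite -overlap_swapD !addr0. Qed.

Lemma overlap_swapZ a x :
  overlap_swap (ta_struct f g a *: x) = ta_struct g f a *: overlap_swap x.
Proof.
elim/(@tens_ind _ _ (ta_struct f g) V): x => [|c v|x y IHx IHy].
- by rewrite scaler0 overlap_swap0 scaler0.
- by rewrite scale_tens !overlap_swapE scale_tens mulrC ta_swap_struct mulrC.
- by rewrite scalerDr !overlap_swapD IHx IHy scalerDr.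
Qed.

End Overlap.

Lemma overlap_swapK {A B C : comPzRingType} (f : {rmorphism A -> B})
    (g : {rmorphism A -> C}) (V : lmodType A) :
  cancel (@overlap_swap A B C f g V) (@overlap_swap A C B g f V).
Proof.
move=> x; elim/(@tens_ind _ _ (ta_struct f g) V): x => [|c v|x y IHx IHy].
- by rewrite !overlap_swap0.
- by rewrite !overlap_swapE ta_swapK.
- by rewrite !overlap_swapD IHx IHy.
Qed.

Definition agree_on_overlap {A B C : comPzRingType} (f : {rmorphism A -> B})
    (g : {rmorphism A -> C}) (V : lmodType A)
    (x : base_change g V) (y : base_change f V) : Prop :=
  overlap_swap (to_overlap f x) = to_overlap g y.

Section Agree.
Local Open Scope classical_set_scope.
Context {A B C : comPzRingType} (f : {rmorphism A -> B}) (g : {rmorphism A -> C}).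
Variable V : lmodType A.
Implicit Types (x : base_change g V) (y : base_change f V).

Lemma agree_on_overlap_tens (v : V) :
  agree_on_overlap (tens g 1 v) (tens f 1 v).
Proof. by rewrite /agree_on_overlap !to_overlap_tens overlap_swapE ta_swapE. Qed.

Lemma scale_tens1 (B' : comPzRingType) (f' : {rmorphism A -> B'}) a (v : V) :
  f' a *: tens f' 1 v = tens f' 1 (a *: v).
Proof. by rewrite scale_tens mulr1 -tens_bal mul1r. Qed.

(** [g t *: x] and [1 (x) v] have the same restriction to the overlap, so some [u] in [T] kills
    their difference. *)
Lemma agree_on_overlap_section T x y v t : local_along f T ->
  agree_on_overlap x y -> f t *: y = tens f 1 v ->
  exists2 u, T u & g (u * t) *: x = tens g 1 (u *: v).
Proof.
move=> fT xy ty; pose x' := g t *: x - tens g 1 v.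
have x'0 : overlap_swap (to_overlap f x') = 0.
  apply: (addIr (overlap_swap (to_overlap f (tens g 1 v)))).
  rewrite -overlap_swapD -to_overlapD subrK to_overlapZ overlap_swapZ xy.
  by rewrite -to_overlapZ ty -agree_on_overlap_tens add0r.
have [|u Tu ux'] := @to_overlap_eq0 _ _ _ f g V T x' fT.
  by apply: (can_inj (@overlap_swapK _ _ _ f g V)); rewrite x'0 overlap_swap0.
exists u => //; apply/eqP; rewrite -scale_tens1 rmorphM -scalerA -subr_eq0.
by rewrite -scalerBr ux'.
Qed.

End Agree.

(** * Local-to-global statements for the covering *)

Section Gluing.
Local Open Scope classical_set_scope.
Context {R : comPzRingType} {n : nat} {S : 'I_n -> comPzRingType}.
Context (f : forall l, {rmorphism R -> S l}) (f_cover : affine_open_covering f).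
Variable V : lmodType R.

Lemma covering_ideal_eq1 (I : set R) : is_ideal I ->
  (forall l (q : spec (S l)), exists2 t, I t & ~ spec_set q (f l t)) -> I 1.
Proof.
move=> idI Iq; apply: ideal_eq1 => // p.
have [_ covT] := f_cover.
have [l _ [q _ <-]] : (\bigcup_(l in setT) range (spec_map (f l))) p by rewrite covT.
by have [t It qt] := Iq l q; exists t.
Qed.

Lemma covering_local l (q : spec (S l)) :
  local_along (f l) [set t | ~ spec_set q (f l t)].
Proof. exact/open_immersion_local/(f_cover.1). Qed.

(** The annihilator of [v - v'] contains, for each point of the covering, an element not vanishing
    there. *)
Lemma covering_eq (v v' : V) :
  (forall l, tens (f l) 1 v = tens (f l) 1 v') -> v = v'.
Proof.
move=> vv'; suff: 1 *: (v - v') = 0 by rewrite scale1r => /eqP; rewrite subr_eq0 => /eqP.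
apply: (@covering_ideal_eq1 [set t | t *: (v - v') = 0]) => [|l q].
  split=> /= [|x y x0 y0|a x x0]; first exact: scale0r.
    by rewrite scalerDl x0 y0 addr0.
  by rewrite -scalerA x0 scaler0.
have [|t qt tv] := tens1_eq0 (covering_local q) (m := v - v'); last by exists t.
apply: (addIr (tens (f l) 1 v')).
by rewrite -tensDr subrK add0r vv'.
Qed.

Lemma section_fraction l (q : spec (S l)) (y : base_change (f l) V) :
  exists2 t, ~ spec_set q (f l t) & exists v, f l t *: y = tens (f l) 1 v.
Proof.
have [[T1 TM] fF _] := covering_local q.
elim/(@tens_ind _ _ (f l) V): y => [|b v|x y [t Tt [v tx]] [u Tu [w uy]]].
- by exists 1 => //; exists 0; rewrite scaler0 tens0r.
- have [t Tt [r tb]] := fF b; exists t => //; exists (r *: v).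
  by rewrite scale_tens tb -scale_tens1 scale_tens mulr1.
- exists (t * u); first exact: TM.
  exists (u *: v + t *: w); rewrite tensDr -!scale_tens1 -tx -uy.
  by rewrite !scalerA -!rmorphM scalerDr (mulrC u).
Qed.

(** The [t] for which all [t x_l] come from a single [v] form an ideal [I]. Near a point of Spec
    S_j, [x j] is a fraction [v / t], and a factor [u l] makes this formula valid for [x l]. *)
Lemma covering_glue (x : forall l, base_change (f l) V) :
  (forall j l, agree_on_overlap (x l) (x j)) ->
  exists v, forall l, x l = tens (f l) 1 v.
Proof.
move=> xx; pose I := [set t | exists v, forall l, f l t *: x l = tens (f l) 1 v].
suff [v xv] : I 1 by exists v => l; rewrite -xv rmorph1 scale1r.
apply: covering_ideal_eq1 => [|j q].
  split=> [|s t [v sv] [w tw]|a t [v tv]].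
  - by exists 0 => l; rewrite rmorph0 scale0r tens0r.
  - by exists (v + w) => l; rewrite rmorphD scalerDl sv tw tensDr.
  - by exists (a *: v) => l; rewrite rmorphM -scalerA tv scale_tens1.
have fT := covering_local q; have [[T1 TM] _ _] := fT.
have [t Tt [v tv]] := section_fraction q (x j).
have [u uP] : {u : 'I_n -> R & forall l, ~ spec_set q (f j (u l)) /\
    f l (u l * t) *: x l = tens (f l) 1 (u l *: v)}.
  apply: (choice (P := fun l u => ~ spec_set q (f j u) /\
    f l (u * t) *: x l = tens (f l) 1 (u *: v))) => l.
  by have [u] := agree_on_overlap_section fT (xx j l) tv; exists u.
(* The covering is finite, so the product is a common multiple of all the [u l * t]. *)
exists ((\prod_l u l) * t); last first.
  apply: (TM) => //; elim/big_ind: _ => // l _; exact: (uP l).1.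
exists ((\prod_l u l) *: v) => l; rewrite (bigD1 l) //= [u l * _]mulrC.
by rewrite -mulrA rmorphM -[RHS]scale1r -!scalerA (uP l).2 scale_tens1 scale1r.
Qed.

End Gluing.

Theorem proposition6p4 (K R : comPzRingType) (k : {rmorphism K -> R})
  (n : nat) (S : 'I_n -> comPzRingType) (f : forall l, {rmorphism R -> S l})
  (S_cover : affine_open_covering f)
  (U V : lmodType R)
  (D : forall l, base_change (f l) U -> base_change (f l) V)
  (D_diff : forall l, diff_op (f l \o k) (D l))
  (D_compat : forall (j l : 'I_n)
     (Djl : base_change (ta_struct (f j) (f l)) U ->
            base_change (ta_struct (f j) (f l)) V)
     (Dlj : base_change (ta_struct (f l) (f j)) U ->
            base_change (ta_struct (f l) (f j)) V),
     induced_trans (ta_struct (f j) (f l) \o k)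
       (ta_inr (f j) (f l)) (D l) Djl ->
     induced_trans (ta_struct (f l) (f j) \o k)
       (ta_inr (f l) (f j)) (D j) Dlj ->
     forall x : base_change (ta_struct (f j) (f l)) U,
       bc_map (@ta_swap _ _ _ (f j) (f l)) (Djl x) =
       Dlj (bc_map (@ta_swap _ _ _ (f j) (f l)) x)) :
  exists! D0 : U -> V,
    diff_op k D0 /\ forall l, induced (f l \o k) D0 (D l).
Proof.
have fl l (q : spec (S l)) := covering_local S_cover q.
have glued u : exists v, forall l, D l (tens (f l) 1 u) = tens (f l) 1 v.
  apply: (covering_glue S_cover) => j l.
  (* [D_compat] takes both induced operators on the overlap as arguments; they exist because both
     maps [ta_inr] are flat epimorphisms. *)
  have [Djl DjlP] := induced_trans_ex (fun a => esym (ta_inr_struct (f j) (f l) a))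
    (ta_inr_flat_epi (f l) (@fl j)) (D_diff l).
  have [Dlj DljP] := induced_trans_ex (fun a => esym (ta_inr_struct (f l) (f j) a))
    (ta_inr_flat_epi (f j) (@fl l)) (D_diff j).
  rewrite /agree_on_overlap /to_overlap -DjlP.2 -DljP.2.
  rewrite /overlap_swap (D_compat _ _ _ _ DjlP DljP); congr Dlj.
  exact: agree_on_overlap_tens.
have [D0 D0P] := choice glued.
have D0_diff : diff_op k D0.
  split=> [kappa x y|a].
  - apply: (covering_eq S_cover) => l.
    rewrite -D0P tensDr -scale_tens1 (D_diff l).1 D0P D0P.
    by rewrite tensDr scale_tens1.
  - have [m mP] : {m : 'I_n -> nat & forall l x,
        iter (m l).+1 (theta (f l a)) (D l) x = 0}.
      exact: (choice (fun l => (D_diff l).2 (f l a))).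
    (* By finiteness of the covering, the largest exponent serves all indices. *)
    exists (\max_l m l) => x; apply: (covering_eq S_cover) => l.
    have iterE N y : iter N (theta (f l a)) (D l) (tens (f l) 1 y) =
        tens (f l) 1 (iter N (theta a) D0 y).
      elim: N y => [|N IHN] y; first exact: D0P.
      rewrite !iterS {1 3}/theta !scale_tens1 !IHN.
      apply: (addIr (tens (f l) 1 (iter N (theta a) D0 (a *: y)))).
      by rewrite subrK -tensDr subrK scale_tens1.
    rewrite -iterE tens0r; have ml : (m l <= \max_l m l)%N by apply: leq_bigmax.
    rewrite -(subnK ml) -addnS thetaE.
    rewrite iter_zero //; first exact: biop_dtheta.
    by apply/funext => z; rewrite -thetaE mP.
exists D0; split=> [|D1 [_ D1P]]; first by split=> // l; split.
apply/funext => u; apply: (covering_eq S_cover) => l.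
by rewrite -D0P (D1P l).2.
Qed.
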